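(* Let $0<p<t<1$ and suppose $(p,t)$ satisfies the minorant condition with parameter $\alpha$ for some $\alpha\in(0,1]$. Let $\beta$ be such that $\frac\beta6$ is a subdifferential, at $x=t^{3\alpha}$, of the convex minorant of the function $x\mapsto\phi_p(x^{1/(3\alpha)})$ on $[0,1]$. Then the triangle tilt $\mathbb{Q}_n^{h_p,\beta,\alpha}$ with parameters $(h_p,\beta,\alpha)$, $h_p=\log\frac p{1-p}$, produces an asymptotically optimal importance sampling scheme (for the event $\mathcal{W}_t$ under $\mathbb{P}_{n,p}$). Moreover, if $u\mapsto\phi_p(u)$ is differentiable at $t$, then $$\beta=\frac{2\phi_p'(t)}{\alpha t^{3\alpha-1}}.$$
   Context: **Graphons.** $\mathcal{W}$ is the set of measurable symmetric functions $f:[0,1]^2\to[0,1]$, modulo identifying $f$ and $g$ when $f(x,y)=g(\sigma x,\sigma y)$ for a measure-preserving bijection $\sigma$ of $[0,1]$. For $f\in\mathcal{W}$: $\mathcal{E}(f)=\int\int f(x,y)\,dx\,dy$, $\mathcal{T}(f)=\int\int\int f(x,y)f(y,z)f(x,z)\,dx\,dy\,dz$ (integrals over $[0,1]$), and $\mathcal{W}_t=\{f\in\mathcal{W}:\mathcal{T}(f)\ge t^3\}$. **Rate function.** $I_p(u)=\frac12\left(u\log\frac up+(1-u)\log\frac{1-u}{1-p}\right)$ for $u\in[0,1]$ (with $0\log 0=0$), $\mathcal{I}_p(f)=\int_0^1\int_0^1I_p(f(x,y))\,dx\,dy$, and $\phi_p(u)=\inf\{\mathcal{I}_p(f):f\in\mathcal{W},\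 \mathcal{T}(f)=u^3\}$ for $u\in[0,1]$. **Minorant condition.** $(p,t)$ satisfies the minorant condition with parameter $\alpha$ if the point $(t^{3\alpha},\phi_p(t))$ lies on the convex minorant (largest convex function lying below) of the function $x\mapsto\phi_p(x^{1/(3\alpha)})$, $x\in[0,1]$. The subdifferentials of a convex function at a point are the slopes of the lines lying below the function and touching it at that point. **Graphs.** $\Omega_n=\{0,1\}^{\binom n2}$ is the set of simple graphs $X$ on $n$ vertices. $X$ is identified with the graphon equal to $X_{ij}$ on $[\frac{i-1}n,\frac in)\times[\frac{j-1}n,\frac jn)$ ($X_{ji}=X_{ij}$, $X_{ii}=0$), so $\mathcal{E}(X)=\frac2{n^2}\#\{\text{edges}\}$ and $\mathcal{T}(X)=\frac6{n^3}\#\{\text{triangles}\}$. $\mathbb{P}_{n,p}$ is the law of the Erdős–Rényi graph $\mathcal{G}_{n,p}$ (independent edges with probability $p$). **Triangle tilt.** $\mathbb{Q}_n^{h_p,\beta,\alpha}$ is the probability measure on $\Omega_n$ with $\mathbb{Q}_n^{h_p,\beta,\alpha}(X)\propto\exp\left(n^2\left(\frac{h_p}2\mathcal{E}(X)+\frac\beta6\mathcal{T}(X)^\alpha\right)\right)$. **Asymptotic optimality.** Importance sampling based on $\mathbb{Q}_n$ estimates $\mathbb{P}_{n,p}(\mathcal{W}_t)$ by averaging $\mathbf{1}_{\mathcal{W}_t}(\tilde X)\frac{d\mathbb{P}_{n,p}}{d\mathbb{Q}_n}(\tilde X)$ over i.i.d. samples $\tilde X\sim\mathbb{Q}_n$.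 The scheme based on $\mathbb{Q}_n$ is (asymptotically) optimal if $$\lim_{n\to\infty}\frac1{n^2}\log\mathbb{E}_{\mathbb{Q}_n}\left[\left(\mathbf{1}_{\mathcal{W}_t}\frac{d\mathbb{P}_{n,p}}{d\mathbb{Q}_n}\right)^2\right]=-2\inf_{f\in\mathcal{W}_t}\mathcal{I}_p(f).$$ *)

(* Defs.v *)
From HB Require Import structures.
From mathcomp Require Import all_boot all_order all_algebra.
From mathcomp Require Import all_classical all_reals all_analysis.

Set Implicit Arguments.
Unset Strict Implicit.
Unset Printing Implicit Defensive.

Import Order.TTheory GRing.Theory Num.Theory.
Import numFieldNormedType.Exports.

Local Open Scope classical_set_scope.
Local Open Scope ring_scope.

Section Graphons.
Variable R : realType.
Local Notation mu := (@lebesgue_measure R).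
Implicit Types (f : R * R -> R) (p t u : R).

(* Graphons are represented by functions on the plane of which only the values
   on the unit square matter.  The functionals below are invariant under
   relabelling by a measure-preserving bijection, so no quotient is taken. *)
Definition graphons : set (R * R -> R) :=
  [set f : R * R -> R |
    [/\ measurable_fun ((`[0, 1] : set R) `*` (`[0, 1] : set R)) f,
        forall x y, x \in `[0, 1] -> y \in `[0, 1] -> f (x, y) = f (y, x) &
        forall x y, x \in `[0, 1] -> y \in `[0, 1] -> 0 <= f (x, y) <= 1]].

Definition edge_density f : R :=
  \int[mu]_(x in `[0, 1]) \int[mu]_(y in `[0, 1]) f (x, y).

Definition triangle_density f : R :=
  \int[mu]_(x in `[0, 1]) \int[mu]_(y in `[0, 1]) \int[mu]_(z in `[0, 1])
    (f (x, y) * f (y, z) * f (x, z)).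

Definition upper_tail t : set (R * R -> R) :=
  [set f | graphons f /\ t ^+ 3 <= triangle_density f].

(* 0 log 0 = 0 at u = 0 and u = 1 because of the factors u and 1 - u. *)
Definition rate p u : R :=
  2^-1 * (u * ln (u / p) + (1 - u) * ln ((1 - u) / (1 - p))).

Definition graphon_rate p f : R :=
  \int[mu]_(x in `[0, 1]) \int[mu]_(y in `[0, 1]) rate p (f (x, y)).

(* For 0 < p < 1 and u in [0, 1] the infimum is over a nonempty set of
   nonnegative reals; for u outside [0, 1] the set is empty and phi p u = 0. *)
Definition phi p u : R :=
  inf [set graphon_rate p f | f in
        [set f | graphons f /\ triangle_density f = u ^+ 3]].

End Graphons.

Section ConvexMinorant.
Variable R : realType.
Implicit Types (g h : R -> R) (x s : R).

Definition convex_below g : set (R -> R) :=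
  [set h | @convex_function R R^o `[0, 1] h /\
           forall x, x \in `[0, 1] -> h x <= g x].

Definition convex_minorant g x : R := sup [set h x | h in convex_below g].

(* The pointwise supremum is itself convex and below g, hence the largest
   convex function below g; see convex_minorantP. *)
Lemma convex_minorantP g : (forall x, x \in `[0, 1] -> 0 <= g x) ->
  convex_below g (convex_minorant g) /\
  forall h, convex_below g h ->
    forall x, x \in `[0, 1] -> h x <= convex_minorant g x.
Proof.
move=> g0.
have ub x : x \in `[0, 1] -> ubound [set h x | h in convex_below g] (g x).
  by move=> x01 _ [h [_ hg]] <-; exact: hg.
have ne x : [set h x | h in convex_below g] !=set0.
  exists 0, (cst 0) => //; split => [t a b _ _|y y01]; last exact: g0.
  by rewrite /cst convmm.
have largest h : convex_below g h ->
    forall x, x \in `[0, 1] -> h x <= convex_minorant g x.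
  move=> hg x x01; apply: ub_le_sup; last by exists h.
  by exists (g x); exact: ub.
split => //; split => [t a b a01 b01|x x01]; last first.
  by apply: ge_sup => //; exact: ub.
apply: ge_sup => // _ [h [hc hg]] <-.
apply: (le_trans (hc t a b a01 b01)).
have la : h a <= convex_minorant g a.
  by apply: largest => //; move: a01; rewrite inE.
have lb : h b <= convex_minorant g b.
  by apply: largest => //; move: b01; rewrite inE.
by rewrite !convRE lerD// ler_wpM2l// subr_ge0.
Qed.

Definition subdifferential h x : set R :=
  [set s | forall y, y \in `[0, 1] -> h x + s * (y - x) <= h y].

End ConvexMinorant.

Definition rescaled_phi (R : realType) (p alpha : R) : R -> R :=
  fun x => phi p (x `^ (3 * alpha)^-1).

Definition minorant_condition (R : realType) (p t alpha : R) : Prop :=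
  convex_minorant (rescaled_phi p alpha) (t `^ (3 * alpha)) = phi p t.

(* Unordered pairs of distinct vertices, so that a graph is an element of
   {0,1}^(n choose 2). *)
Definition vertex_pair (n : nat) := {e : 'I_n * 'I_n | (e.1 < e.2)%N}.

Definition graph (n : nat) := {ffun vertex_pair n -> bool}.

Definition adjacent n (X : graph n) (i j : 'I_n) : bool :=
  [exists e : vertex_pair n, X e && (val e \in [:: (i, j); (j, i)])].

Section Sampling.
Variable R : realType.
Implicit Types (p t h beta alpha : R).

Definition cell n (i : 'I_n) : set R := `[i%:R / n%:R, i.+1%:R / n%:R[.

Definition graphon_of n (X : graph n) : R * R -> R := fun z =>
  \sum_(i < n) \sum_(j < n)
    (adjacent X i j)%:R * \1_(cell i) z.1 * \1_(cell j) z.2.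

Definition erdos_renyi n p (X : graph n) : R :=
  \prod_(e : vertex_pair n) (if X e then p else 1 - p).

Definition tilt_weight n h beta alpha (X : graph n) : R :=
  expR (n%:R ^+ 2 * (h / 2 * edge_density (graphon_of X)
                     + beta / 6 * triangle_density (graphon_of X) `^ alpha)).

Definition triangle_tilt n h beta alpha (X : graph n) : R :=
  tilt_weight h beta alpha X / \sum_(Y : graph n) tilt_weight h beta alpha Y.

Definition expect n (q F : graph n -> R) : R := \sum_(X : graph n) q X * F X.

(* Laws on graphs are given by their mass functions, and the density dP/dQ is
   the ratio of the mass functions (Q is meant to have full support). *)
Definition is_estimator n p t (q : graph n -> R) (X : graph n) : R :=
  \1_(upper_tail t) (graphon_of X) * (erdos_renyi p X / q X).

Definition asymptotically_optimal p t (q : forall n, graph n -> R) : Prop :=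
  (fun n => ln (expect (q n) (fun X => is_estimator p t (q n) X ^+ 2))
            / n%:R ^+ 2) @ \oo
    --> - 2 * inf [set graphon_rate p f | f in upper_tail t].

End Sampling.

(* Main.v *)
Require Import Defs.
From HB Require Import structures.
From mathcomp Require Import all_boot all_order all_algebra.
From mathcomp Require Import all_classical all_reals all_analysis.
From mathcomp Require Import measurable_realfun.
From mathcomp Require Import zify ring lra.

(** Write [g w] for [beta / 6 * w ^ alpha], [T] for the triangle density, [I]
    for the rate of a graphon, and [L = g (t ^ 3) - phi t].

    The minorant condition and the choice of [beta] say that the line of slope
    [beta / 6] through [(t ^ (3 alpha), phi t)] stays below the rescaled rate
    function.  Read on graphons this is the inequality [g (T f) - I f <= L] for
    every graphon [f] ([graphon_tangent]).  Comparing with the point [p], where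
    [phi] vanishes, shows that [beta] is nonnegative ([beta_ge0]), and where
    [phi] is differentiable the line must be its tangent, which is the formula
    for [beta] ([beta_derivative]).

    Since [h_p = log (p / (1 - p))], the tilted law has density [exp (n^2 g T) / M]
    with respect to the Erdos-Renyi law [P], where [M = E_P (exp (n^2 g T))].
    The second moment of the estimator is therefore [M * E_P (1_A exp (- n^2 g T))]
    with [A] the event [t ^ 3 <= T] ([second_momentE]).  As [g] is nondecreasing
    this is at most [(M exp (- n^2 g (t ^ 3))) ^ 2], and by the Cauchy-Schwarz
    inequality it is at least [P A ^ 2].  Because the infimum of [I] over the
    upper tail is at most [phi t], it remains to show that [M] is at most
    [exp (n^2 (L + o(1)))] and that [P A] is at least [exp (- n^2 (I f + o(1)))]
    for every [f] in the upper tail.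

    Upper bound ([tilted_mean_upper]).  Let [y] be the edge probabilities of the
    random graph conditioned on an event.  Comparing the conditioned law with the
    product law of the same edge probabilities bounds the probability of the
    event by the exponential of minus the relative entropy of that product law
    ([entropy_bound]).  On the other hand every adjacency matrix is close in cut
    norm to a combination of boundedly many rectangles ([block_approx]), so that
    the graphs fall into [exp (O(n))] classes of small diameter.  A ball in cut
    norm is convex and the triangle density is continuous in cut norm
    ([triangle_sum_cut]); hence on each class [T] is nearly constant and nearly
    equal to its value at [y], and the inequality [g (T f) - I f <= L] applies
    with [f] the graphon of [y].

    Lower bound ([upper_tail_lower]).  A graphon of the upper tail is moved a
    little towards 1, which raises its triangle density strictly
    ([perturb_graphon]), and then approximated in L^1 by a step function on the
    grid of mesh [1 / n], for every large [n] ([approximable_measurable]).  Under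
    independent edges with the probabilities given by that step function the mean
    of [T] exceeds [t ^ 3] by a fixed amount, so [A] has probability bounded away
    from 0, while the log-likelihood ratio concentrates around its mean, the
    relative entropy ([chernoff]).  A change of measure concludes
    ([finite_lower]). *)

Set Implicit Arguments.
Unset Strict Implicit.
Unset Printing Implicit Defensive.

Import Order.TTheory GRing.Theory Num.Theory.
Import numFieldNormedType.Exports.

Local Open Scope classical_set_scope.
Local Open Scope ring_scope.

(** * Iterated integrals of bounded measurable functions over the unit interval *)

Section UnitInterval.
Variable R : realType.
Local Notation mu := (@lebesgue_measure R).

(** A class of integrands that is closed under products, absolute values and
    partial integration, so that every iterated integral below exists. *)
Definition bounded_measurable d (X : measurableType d) (h : X -> R) :=
  measurable_fun setT h /\ exists C, forall x, `|h x| <= C.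

Definition int01 (h : R -> R) : R := \int[mu]_(x in `[0, 1]) h x.

Let mu01 : mu (`[0, 1] : set R) = 1%E.
Proof. by rewrite lebesgue_measure_itv/= lte01 oppr0 adde0. Qed.

Let cst_integrable c : mu.-integrable (`[0, 1] : set R) (EFin \o cst c).
Proof.
have muy : (mu (`[0%R, 1%R] : set R) < +oo)%E by rewrite mu01 ltry.
by apply: measurable_bounded_integrable => //; exact: bounded_cst.
Qed.

Section closure.
Context d (X : measurableType d).
Implicit Types h k : X -> R.

Lemma bounded_measurable_cst c : bounded_measurable (fun _ : X => c).
Proof. by split; [exact: measurable_cst|exists `|c|]. Qed.

Lemma bounded_measurable01 h : measurable_fun setT h ->
  (forall x, 0 <= h x <= 1) -> bounded_measurable h.
Proof.
move=> mh h01; split; [exact: mh|exists 1 => x].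
by have /andP[h0 h1] := h01 x; rewrite (ger0_norm h0).
Qed.

Lemma bounded_measurableD h k : bounded_measurable h -> bounded_measurable k ->
  bounded_measurable (fun x => h x + k x).
Proof.
move=> [mh [C hC]] [mk [D kD]]; split; first exact: measurable_funD.
by exists (C + D) => x; rewrite (le_trans (ler_normD _ _))// lerD.
Qed.

Lemma bounded_measurableM h k : bounded_measurable h -> bounded_measurable k ->
  bounded_measurable (fun x => h x * k x).
Proof.
move=> [mh [C hC]] [mk [D kD]]; split; first exact: measurable_funM.
by exists (C * D) => x; rewrite normrM ler_pM.
Qed.

Lemma bounded_measurableB h k : bounded_measurable h -> bounded_measurable k ->
  bounded_measurable (fun x => h x - k x).
Proof.
move=> [mh [C hC]] [mk [D kD]]; split; first exact: measurable_funB.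
by exists (C + D) => x; rewrite (le_trans (ler_normB _ _))// lerD.
Qed.

Lemma bounded_measurable_norm h : bounded_measurable h ->
  bounded_measurable (fun x => `|h x|).
Proof.
move=> [mh [C hC]]; split; first exact: measurableT_comp.
by exists C => x; rewrite normr_id.
Qed.

Lemma bounded_measurable_comp d' (Y : measurableType d') (g : Y -> X) h :
  measurable_fun setT g -> bounded_measurable h ->
  bounded_measurable (fun y => h (g y)).
Proof.
move=> mg [mh [C hC]]; split; first exact: measurableT_comp.
by exists C => y.
Qed.

Lemma bounded_measurable_indic (A : set X) : measurable A ->
  bounded_measurable (\1_A : X -> R).
Proof.
move=> mA; split; first exact: measurable_indic.
by exists 1 => x; rewrite indicE ger0_norm ?lern1 ?leq_b1.
Qed.

Lemma bounded_measurable_sum (I : Type) (s : seq I) (F : I -> X -> R) :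
  (forall i, bounded_measurable (F i)) ->
  bounded_measurable (fun x => \sum_(i <- s) F i x).
Proof.
move=> mF; elim: s => [|i s ih].
  rewrite (_ : (fun _ => _) = cst 0); first exact: bounded_measurable_cst.
  by apply/funext => x; rewrite big_nil.
rewrite (_ : (fun _ => _) = fun x => F i x + \sum_(i <- s) F i x).
  exact: bounded_measurableD.
by apply/funext => x; rewrite big_cons.
Qed.

End closure.

Lemma bounded_measurable_integrable (h : R -> R) :
  bounded_measurable h -> mu.-integrable `[0, 1] (EFin \o h).
Proof.
move=> [mh [C hC]]; apply: (@le_integrable _ _ _ mu _ _ _ (EFin \o cst C)) => //.
- by apply/measurable_EFinP; exact: measurable_funTS.
- by move=> x _ /=; rewrite lee_fin (le_trans (hC x))// ler_norm.
Qed.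

Lemma int01_cst c : int01 (fun=> c) = c.
Proof. by rewrite /int01 Rintegral_cst//= lebesgue_measure_itv/= lte01 oppr0 adde0 mulr1. Qed.

Lemma EFin_int01 (h : R -> R) : bounded_measurable h ->
  (int01 h)%:E = (\int[mu]_(x in `[0%R, 1%R]) (h x)%:E)%E.
Proof.
move=> mh; rewrite /int01 /Rintegral fineK//.
exact: integrable_fin_num (bounded_measurable_integrable mh).
Qed.

Lemma int01D (h k : R -> R) : bounded_measurable h -> bounded_measurable k ->
  int01 (fun x => h x + k x) = int01 h + int01 k.
Proof.
by move=> ? ?; rewrite /int01 RintegralD//; exact: bounded_measurable_integrable.
Qed.

Lemma int01Dc (h : R -> R) c : bounded_measurable h ->
  int01 (fun x => h x + c) = int01 h + c.
Proof.
move=> bh; rewrite int01D//; last exact: bounded_measurable_cst.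
by rewrite int01_cst.
Qed.

Lemma int01Z c (h : R -> R) : bounded_measurable h ->
  int01 (fun x => c * h x) = c * int01 h.
Proof.
by move=> ?; rewrite /int01 RintegralZl//; exact: bounded_measurable_integrable.
Qed.

Lemma int01_ext (h k : R -> R) : (forall x, x \in `[0, 1] -> h x = k x) ->
  int01 h = int01 k.
Proof. by move=> hk; apply: eq_Rintegral => x; rewrite inE/=; exact: hk. Qed.

Lemma int01_le (h k : R -> R) : bounded_measurable h -> bounded_measurable k ->
  (forall x, x \in `[0, 1] -> h x <= k x) -> int01 h <= int01 k.
Proof.
move=> mh mk hk.
by apply: le_Rintegral => //; exact: bounded_measurable_integrable.
Qed.

Lemma int01_ge0 (h : R -> R) : (forall x, x \in `[0, 1] -> 0 <= h x) -> 0 <= int01 h.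
Proof. by move=> h0; apply: Rintegral_ge0. Qed.

Lemma int01_norm (h : R -> R) : bounded_measurable h ->
  `|int01 h| <= int01 (fun x => `|h x|).
Proof.
by move=> mh; apply: le_normr_Rintegral => //;
  exact: bounded_measurable_integrable.
Qed.

Lemma int01_sum (I : Type) (s : seq I) (F : I -> R -> R) :
  (forall i, bounded_measurable (F i)) ->
  int01 (fun x => \sum_(i <- s) F i x) = \sum_(i <- s) int01 (F i).
Proof.
move=> mF; elim: s => [|i s ih].
  by under int01_ext do rewrite big_nil; rewrite int01_cst big_nil.
rewrite big_cons -ih -int01D//; last exact: bounded_measurable_sum.
by apply: int01_ext => x _; rewrite big_cons.
Qed.

(** Adding a constant makes the integrand nonnegative, where Tonelli's theorem
    gives measurability of the partial integral. *)
Lemma bounded_measurable_int01 d (X : measurableType d) (h : X * R -> R) :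
  bounded_measurable h -> bounded_measurable (fun x => int01 (fun y => h (x, y))).
Proof.
move=> [mh [C hC]].
have bsec x : bounded_measurable (fun y => h (x, y)).
  by apply: bounded_measurable_comp; [exact: pair1_measurable|split => //; exists C].
have bN x : `|int01 (fun y => h (x, y))| <= C.
  rewrite (le_trans (int01_norm (bsec x)))// -[leRHS](int01_cst C).
  apply: int01_le => //; last exact: bounded_measurable_cst.
  exact: bounded_measurable_norm.
split; last by exists C.
pose k (z : X * R) := (h z + C) * \1_(`[0, 1] : set R) z.2.
have mk : measurable_fun setT (EFin \o k).
  apply/measurable_EFinP; apply: measurable_funM.
    by apply: measurable_funD.
  exact: measurableT_comp.
have k0 z : (0 <= (EFin \o k) z)%E.
  rewrite lee_fin mulr_ge0//.
  by rewrite -lerBlDr sub0r; move/lerNnormlW: (hC z).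
have mF := measurable_fun_fubini_tonelli_F (m2 := mu) (EFin \o k) mk k0.
rewrite (_ : (fun _ => _) = fun x => fine (fubini_F mu (EFin \o k) x) - C).
  by apply: measurable_funB => //; exact: measurableT_comp.
apply/funext => x; rewrite /fubini_F.
have -> : int01 (fun y => h (x, y)) = int01 (fun y => h (x, y) + C) - C.
  by rewrite int01D// ?int01_cst ?addrK//; exact: bounded_measurable_cst.
congr (_ - _); rewrite /int01 /Rintegral; congr fine.
rewrite integral_mkcond; apply: eq_integral => y _.
by rewrite patchE /k/= indicE; case: ifPn; rewrite ?mulr1 ?mulr0.
Qed.

(** Tonelli's theorem for [h + C], which is nonnegative; the constant cancels. *)
Lemma int01_swap (h : R * R -> R) : bounded_measurable h ->
  int01 (fun x => int01 (fun y => h (x, y))) =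
  int01 (fun y => int01 (fun x => h (x, y))).
Proof.
move=> bh; have [_ [C hC]] := bh.
pose g z := h z + C.
have bg : bounded_measurable g.
  by apply: bounded_measurableD => //; exact: bounded_measurable_cst.
have g0 z : 0 <= g z by rewrite /g -lerBlDr sub0r; move/lerNnormlW: (hC z).
have b1 (f : R * R -> R) x : bounded_measurable f ->
    bounded_measurable (fun y => f (x, y)).
  by move=> bf; apply: bounded_measurable_comp bf; exact: pair1_measurable.
have b2 (f : R * R -> R) y : bounded_measurable f ->
    bounded_measurable (fun x => f (x, y)).
  by move=> bf; apply: bounded_measurable_comp bf; exact: pair2_measurable.
have bsw (f : R * R -> R) : bounded_measurable f ->
    bounded_measurable (fun y => int01 (fun x => f (x, y))).
  move=> bf; pose f' (z : R * R) := f (z.2, z.1).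
  apply: (@bounded_measurable_int01 _ R f').
  apply: bounded_measurable_comp bf.
  exact: measurable_fun_pair.
suff gg : int01 (fun x => int01 (fun y => g (x, y))) =
          int01 (fun y => int01 (fun x => g (x, y))).
  apply: (@addIr _ C); rewrite -int01Dc; last exact: bounded_measurable_int01.
  rewrite -int01Dc; last exact: bsw.
  transitivity (int01 (fun x => int01 (fun y => g (x, y)))).
    by apply: int01_ext => x _; rewrite -int01Dc//; exact: b1.
  by rewrite gg; apply: int01_ext => x _; rewrite int01Dc//; exact: b2.
pose J (x : R) : R := \1_(`[0, 1] : set R) x.
pose k z := g z * (J z.1 * J z.2).
have mJ : measurable_fun setT J by exact: measurable_indic.
have mk : measurable_fun setT (EFin \o k).
  apply/measurable_EFinP; apply: measurable_funM; first by case: bg.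
  by apply: measurable_funM; exact: measurableT_comp.
have k0 z : (0 <= (EFin \o k) z)%E by rewrite lee_fin !mulr_ge0// indicE.
apply/eqP; rewrite -eqe; apply/eqP.
have restr (f : R -> \bar R) : (\int[mu]_(x in `[0%R, 1%R]) f x =
     \int[mu]_x (if x \in `[0%R, 1%R]%classic then f x else 0))%E.
  by rewrite integral_mkcond; apply: eq_integral.
have E1 : ((int01 (fun x => int01 (fun y => g (x, y))))%:E =
          \int[mu]_x \int[mu]_y (EFin \o k) (x, y))%E.
  rewrite EFin_int01; last exact: bounded_measurable_int01.
  rewrite restr; apply: eq_integral => x _; rewrite /k/= /J indicE.
  case: ifPn => [x01|_]; last first.
    by rewrite [RHS]integral0_eq// => y _; rewrite mul0r mulr0.
  rewrite EFin_int01; last exact: b1.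
  rewrite restr; apply: eq_integral => y _; rewrite indicE mul1r.
  by case: ifPn => _; rewrite ?mulr1 ?mulr0.
have E2 : ((int01 (fun y => int01 (fun x => g (x, y))))%:E =
          \int[mu]_y \int[mu]_x (EFin \o k) (x, y))%E.
  rewrite EFin_int01; last exact: bsw.
  rewrite restr; apply: eq_integral => x _; rewrite /k/= /J indicE.
  case: ifPn => [x01|_]; last first.
    by rewrite [RHS]integral0_eq// => y _; rewrite mulr0 mulr0.
  rewrite EFin_int01; last exact: b2.
  rewrite restr; apply: eq_integral => y _; rewrite indicE mulr1.
  by case: ifPn => _; rewrite ?mulr1 ?mulr0.
rewrite E1 E2; exact: (fubini_tonelli (m1 := mu) (m2 := mu) (EFin \o k) mk k0).
Qed.

Lemma int01_cvg (h_ : nat -> R -> R) (h : R -> R) (C : R) :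
  (forall n, measurable_fun setT (h_ n)) -> (forall n x, `|h_ n x| <= C) ->
  (forall x, h_ ^~ x @ \oo --> h x) ->
  int01 (h_ n) @[n --> \oo] --> int01 h.
Proof.
move=> mh hC hh.
have mh' : measurable_fun setT h.
  by apply: (measurable_fun_cvg mh) => x _; exact: hh.
have [] := @dominated_convergence _ _ _ mu `[0, 1] _
  (fun n => EFin \o h_ n) (EFin \o h) (EFin \o cst C).
- by [].
- move=> n; apply/measurable_EFinP; apply: measurable_funTS; exact: mh.
- by apply/measurable_EFinP; exact: measurable_funTS.
- apply: aeW => x _; apply/fine_cvgP; split; first by apply: nearW => n.
  exact: hh.
- exact: cst_integrable.
- by apply: aeW => x n _ /=; rewrite lee_fin.
move=> ih _ cv; rewrite /int01 /Rintegral.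
apply: fine_cvg; rewrite fineK//.
exact: integrable_fin_num ih.
Qed.

Lemma int01E (h : R -> R) : int01 h = \int[mu]_(x in `[0, 1]) h x.
Proof. by []. Qed.

Definition int3 (k : R * R * R -> R) : R :=
  int01 (fun x => int01 (fun y => int01 (fun z => k (x, y, z)))).
Definition int2 (k : R * R -> R) : R :=
  int01 (fun x => int01 (fun y => k (x, y))).

Lemma edge_densityE (f : R * R -> R) : edge_density f = int2 f.
Proof. by []. Qed.

Lemma triangle_densityE (f : R * R -> R) : triangle_density f =
  int3 (fun w => f (w.1.1, w.1.2) * f (w.1.2, w.2) * f (w.1.1, w.2)).
Proof. by []. Qed.

Lemma graphon_rateE p (f : R * R -> R) :
  graphon_rate p f = int2 (fun z => rate p (f z)).
Proof. by []. Qed.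

End UnitInterval.

(* From here on integrals are handled through the lemmas above only. *)
Opaque int01.

(** * The triangle density as a function on graphons *)

Section TriangleDensity.
Variable R : realType.
Local Notation mu := (@lebesgue_measure R).

Lemma triangle_integrand_measurable (f g h : R * R -> R) :
  bounded_measurable f -> bounded_measurable g -> bounded_measurable h ->
  bounded_measurable (fun w : R * R * R =>
    f (w.1.1, w.1.2) * g (w.1.2, w.2) * h (w.1.1, w.2)).
Proof.
move=> bf bg bh.
have m11 : measurable_fun setT (fun w : R * R * R => w.1.1).
  exact: (measurableT_comp measurable_fst measurable_fst).
have m12 : measurable_fun setT (fun w : R * R * R => w.1.2).
  exact: (measurableT_comp measurable_snd measurable_fst).
have m2 : measurable_fun setT (fun w : R * R * R => w.2).
  exact: measurable_snd.
apply: bounded_measurableM; first apply: bounded_measurableM.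
- by apply: bounded_measurable_comp bf; exact: measurable_fun_pair.
- by apply: bounded_measurable_comp bg; exact: measurable_fun_pair.
- by apply: bounded_measurable_comp bh; exact: measurable_fun_pair.
Qed.

Lemma bounded_measurable_slice d1 d2 (X : measurableType d1)
    (Y : measurableType d2) (h : X * Y -> R) x :
  bounded_measurable h -> bounded_measurable (fun y => h (x, y)).
Proof. by move=> bh; apply: bounded_measurable_comp bh; exact: pair1_measurable. Qed.

Lemma bounded_measurable_swap (h : R * R -> R) :
  bounded_measurable h -> bounded_measurable (fun z => h (z.2, z.1)).
Proof. by move=> bh; apply: bounded_measurable_comp bh; exact: measurable_fun_pair. Qed.

Section int2.
Implicit Types h k : R * R -> R.

Lemma int2D h k : bounded_measurable h -> bounded_measurable k ->
  int2 (fun z => h z + k z) = int2 h + int2 k.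
Proof.
move=> bh bk; rewrite /int2 -int01D; [|exact: bounded_measurable_int01..].
by apply: int01_ext => x _; rewrite int01D//; exact: bounded_measurable_slice.
Qed.

Lemma int2Z c h : bounded_measurable h ->
  int2 (fun z => c * h z) = c * int2 h.
Proof.
move=> bh; rewrite /int2 -int01Z; last exact: bounded_measurable_int01.
by apply: int01_ext => x _; rewrite int01Z//; exact: bounded_measurable_slice.
Qed.

Lemma int2_cst (c : R) : int2 (fun=> c) = c.
Proof. by rewrite /int2; under int01_ext do rewrite int01_cst; rewrite int01_cst. Qed.

Lemma int2_le h k : bounded_measurable h -> bounded_measurable k ->
  (forall x y, x \in `[0, 1] -> y \in `[0, 1] -> h (x, y) <= k (x, y)) ->
  int2 h <= int2 k.
Proof.
move=> bh bk hk; apply: int01_le; [exact: bounded_measurable_int01..|].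
move=> x x01; apply: int01_le; [exact: bounded_measurable_slice..|].
by move=> y y01; exact: hk.
Qed.

Lemma int2_ext h k :
  (forall x y, x \in `[0, 1] -> y \in `[0, 1] -> h (x, y) = k (x, y)) ->
  int2 h = int2 k.
Proof. by move=> hk; apply: int01_ext => x x01; apply: int01_ext => y; exact: hk. Qed.

Lemma int2_norm h : bounded_measurable h -> `|int2 h| <= int2 (fun z => `|h z|).
Proof.
move=> bh; apply: (le_trans (int01_norm _)).
  exact: bounded_measurable_int01.
apply: int01_le.
- by apply: bounded_measurable_norm; exact: bounded_measurable_int01.
- apply: (bounded_measurable_int01 (h := fun z => `|h z|)).
  exact: bounded_measurable_norm.
- by move=> x _; apply: int01_norm; exact: bounded_measurable_slice.
Qed.

End int2.

Section int3.
Implicit Types h k : R * R * R -> R.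

Lemma int3E k : int3 k = int2 (fun w => int01 (fun z => k (w, z))).
Proof. by []. Qed.

Lemma int3D h k : bounded_measurable h -> bounded_measurable k ->
  int3 (fun z => h z + k z) = int3 h + int3 k.
Proof.
move=> bh bk; rewrite !int3E -int2D; [|exact: bounded_measurable_int01..].
by apply: int2_ext => x y _ _; rewrite int01D//; exact: bounded_measurable_slice.
Qed.

Lemma int3Z c h : bounded_measurable h ->
  int3 (fun z => c * h z) = c * int3 h.
Proof.
move=> bh; rewrite !int3E -int2Z; last exact: bounded_measurable_int01.
by apply: int2_ext => x y _ _; rewrite int01Z//; exact: bounded_measurable_slice.
Qed.

Lemma int3_cst (c : R) : int3 (fun=> c) = c.
Proof. by rewrite int3E; under int2_ext do rewrite int01_cst; rewrite int2_cst. Qed.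

Lemma int3_le h k : bounded_measurable h -> bounded_measurable k ->
  (forall x y z, x \in `[0, 1] -> y \in `[0, 1] -> z \in `[0, 1] ->
    h (x, y, z) <= k (x, y, z)) ->
  int3 h <= int3 k.
Proof.
move=> bh bk hk; rewrite !int3E.
apply: int2_le; [exact: bounded_measurable_int01..|].
move=> x y x01 y01; apply: int01_le; [exact: bounded_measurable_slice..|].
by move=> z z01; exact: hk.
Qed.

Lemma int3_norm h : bounded_measurable h -> `|int3 h| <= int3 (fun z => `|h z|).
Proof.
move=> bh; rewrite !int3E; apply: (le_trans (int2_norm _)).
  exact: bounded_measurable_int01.
apply: int2_le.
- by apply: bounded_measurable_norm; exact: bounded_measurable_int01.
- apply: (bounded_measurable_int01 (h := fun z => `|h z|)).
  exact: bounded_measurable_norm.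
- by move=> x y _ _; apply: int01_norm; exact: bounded_measurable_slice.
Qed.

End int3.

Lemma triple_product_lipschitz (a b c a' b' c' : R) :
  `|b| <= 1 -> `|c| <= 1 -> `|a'| <= 1 -> `|b'| <= 1 ->
  `|a * b * c + -1 * (a' * b' * c')| <= `|a - a'| + `|b - b'| + `|c - c'|.
Proof.
move=> b1 c1 a1 b1'.
have -> : a * b * c + -1 * (a' * b' * c') =
  (a - a') * (b * c) + (b - b') * (a' * c) + (c - c') * (a' * b') by ring.
by do 2?[apply: (le_trans (ler_normD _ _)); apply: lerD];
  rewrite !normrM ler_piMr// mulr_ile1.
Qed.

(** The product of three factors is changed one factor at a time; each time the
    two other factors are at most 1 and one variable integrates out. *)
Lemma triangle_density_lipschitz (f g : R * R -> R) :
  bounded_measurable f -> bounded_measurable g ->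
  (forall z, `|f z| <= 1) -> (forall z, `|g z| <= 1) ->
  `|triangle_density f - triangle_density g| <=
    3 * int2 (fun z => `|f z - g z|).
Proof.
move=> bf bg f1 g1.
pose d z := `|f z - g z|.
have bd : bounded_measurable d.
  exact/bounded_measurable_norm/bounded_measurableB.
have m11 : measurable_fun setT (fun w : R * R * R => w.1.1).
  exact: (measurableT_comp measurable_fst measurable_fst).
have m12 : measurable_fun setT (fun w : R * R * R => w.1.2).
  exact: (measurableT_comp measurable_snd measurable_fst).
have m2 : measurable_fun setT (fun w : R * R * R => w.2).
  exact: measurable_snd.
have b1 : bounded_measurable (fun w : R * R * R => d (w.1.1, w.1.2)).
  by apply: bounded_measurable_comp bd; exact: measurable_fun_pair.
have b2 : bounded_measurable (fun w : R * R * R => d (w.1.2, w.2)).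
  by apply: bounded_measurable_comp bd; exact: measurable_fun_pair.
have b3 : bounded_measurable (fun w : R * R * R => d (w.1.1, w.2)).
  by apply: bounded_measurable_comp bd; exact: measurable_fun_pair.
have bF := triangle_integrand_measurable bf bf bf.
have bG := bounded_measurableM (bounded_measurable_cst _ (-1))
  (triangle_integrand_measurable bg bg bg).
rewrite (_ : triangle_density f - triangle_density g =
    int3 (fun w => f (w.1.1, w.1.2) * f (w.1.2, w.2) * f (w.1.1, w.2) +
      (-1) * (g (w.1.1, w.1.2) * g (w.1.2, w.2) * g (w.1.1, w.2)))); last first.
  rewrite (int3D bF bG) int3Z ?mulN1r//.
  exact: triangle_integrand_measurable.
have e1 : int3 (fun w => d (w.1.1, w.1.2)) = int2 d.
  by rewrite int3E; apply: int2_ext => x y _ _ /=; rewrite int01_cst.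
have e2 : int3 (fun w => d (w.1.2, w.2)) = int2 d by rewrite /int3/= int01_cst.
have e3 : int3 (fun w => d (w.1.1, w.2)) = int2 d.
  by rewrite /int3 /int2; apply: int01_ext => x _ /=; rewrite int01_cst.
have e : 3 * int2 d =
    int3 (fun w => d (w.1.1, w.1.2) + d (w.1.2, w.2) + d (w.1.1, w.2)).
  rewrite (int3D (bounded_measurableD b1 b2) b3) (int3D b1 b2) e1 e2 e3.
  by move: (int2 d) => D; ring.
rewrite -/(int2 d) e.
apply: (le_trans (int3_norm (bounded_measurableD bF bG))).
apply: int3_le.
- exact: bounded_measurable_norm (bounded_measurableD bF bG).
- exact: bounded_measurableD (bounded_measurableD b1 b2) b3.
by move=> x y z _ _ _; exact: triple_product_lipschitz.
Qed.

Lemma mulr3_itv01 (u v w : R) : 0 <= u <= 1 -> 0 <= v <= 1 -> 0 <= w <= 1 ->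
  0 <= u * v * w <= 1.
Proof.
move=> /andP[? ?] /andP[? ?] /andP[? ?].
by rewrite !mulr_ge0//= !mulr_ile1 ?mulr_ge0.
Qed.

(** Graphons are only constrained on the unit square; cutting them off outside
    gives a representative that is measurable and bounded everywhere. *)
Lemma restrict_graphon (f : R * R -> R) : graphons f -> exists F : R * R -> R,
  [/\ measurable_fun setT F, forall z, 0 <= F z <= 1,
      forall x y, 0 <= x < 1 -> 0 <= y < 1 -> F (x, y) = F (y, x),
      triangle_density F = triangle_density f &
      forall p : R, graphon_rate p F = graphon_rate p f].
Proof.
move=> [mf fsym f01]; exists (f \_ ((`[0, 1] : set R) `*` (`[0, 1] : set R))).
have FE x y : x \in `[0, 1] -> y \in `[0, 1] -> (f \_ ((`[0, 1] : set R) `*` (`[0, 1] : set R))) (x, y) = f (x, y).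
  by move=> x01 y01; rewrite patchE mem_set.
split.
- apply/(measurable_restrictT _ _).1 => //.
  by apply: measurableX; exact: measurable_itv.
- move=> [x y]; rewrite patchE; case: ifPn => [|_]; last by rewrite lexx ler01.
  by rewrite inE => -[/= x01 y01]; exact: f01.
- move=> x y /andP[x0 x1] /andP[y0 y1].
  have x01 : x \in `[0, 1] by rewrite in_itv/= x0 ltW.
  have y01 : y \in `[0, 1] by rewrite in_itv/= y0 ltW.
  by rewrite !FE// fsym.
- rewrite !triangle_densityE /int3; apply: int01_ext => x x01.
  apply: int01_ext => y y01; apply: int01_ext => z z01 /=.
  by rewrite !FE.
- move=> p; rewrite !graphon_rateE; apply: int2_ext => x y x01 y01.
  by rewrite FE.
Qed.

Lemma triangle_density01 (f : R * R -> R) : graphons f -> 0 <= triangle_density f <= 1.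
Proof.
move=> gf; have [F [mF F01 _ <- _]] := restrict_graphon gf.
have bF := bounded_measurable01 mF F01.
have bT := triangle_integrand_measurable bF bF bF.
have F3 z1 z2 z3 := mulr3_itv01 (F01 z1) (F01 z2) (F01 z3).
have bc c := bounded_measurable_cst (R * R * R)%type (c : R).
rewrite triangle_densityE; apply/andP; split.
  rewrite -[leLHS](int3_cst (0 : R)); apply: (int3_le (bc 0) bT) => x y z _ _ _.
  by have /andP[] := F3 (x, y) (y, z) (x, z).
rewrite -[leRHS](int3_cst (1 : R)); apply: (int3_le bT (bc 1)) => x y z _ _ _.
by have /andP[] := F3 (x, y) (y, z) (x, z).
Qed.

End TriangleDensity.

(** * The rate function *)

Section Rate.
Variable R : realType.
Implicit Types p u v b : R.

(** This is [ln x <= x - 1] at [x = v / u]; summed over the two outcomes of a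
    Bernoulli variable it says that relative entropy is nonnegative. *)
Lemma subr_le_mulr_ln u v : 0 <= u -> 0 < v -> u - v <= u * ln (u / v).
Proof.
move=> u0 v0; have [->|un0] := eqVneq u 0; first by rewrite mul0r sub0r oppr_le0 ltW.
have u_gt0 : 0 < u by rewrite lt_neqAle eq_sym un0.
have : ln (v / u) <= v / u - 1.
  rewrite -[X in ln X](subrK 1) [X in ln X]addrC; apply: le_ln1Dx.
  by rewrite ltrBrDl subrr divr_gt0.
rewrite -[X in ln X]invf_div lnV ?posrE ?divr_gt0// => h.
have := ler_wpM2l u0 h; rewrite mulrN mulrBr mulr1 mulrCA divff// mulr1.
lra.
Qed.

Lemma mulr_ln_chain u v p : 0 <= u -> 0 < v -> 0 < p ->
  u * ln (u / p) = u * ln (u / v) + u * ln (v / p).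
Proof.
move=> u0 v0 p0; have [->|un0] := eqVneq u 0; first by rewrite !mul0r addr0.
have u_gt0 : 0 < u by rewrite lt_neqAle eq_sym un0.
by rewrite !ln_div// -mulrDr addrA subrK.
Qed.

(** The derivative of [rate p] at [v]. *)
Definition rate_slope p v : R := 2^-1 * (ln (v / p) - ln ((1 - v) / (1 - p))).

(** Twice the difference of the two sides is the relative entropy of a Bernoulli
    variable of mean [u] with respect to one of mean [v]. *)
Lemma rate_tangent p u v : 0 < p < 1 -> 0 <= u <= 1 -> 0 < v < 1 ->
  rate p v + rate_slope p v * (u - v) <= rate p u.
Proof.
move=> /andP[p0 p1] /andP[u0 u1] /andP[v0 v1]; rewrite /rate /rate_slope.
have u1' : 0 <= 1 - u by lra.
have v1' : 0 < 1 - v by lra.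
have p1' : 0 < 1 - p by lra.
rewrite (mulr_ln_chain u0 v0 p0) (mulr_ln_chain u1' v1' p1').
have := subr_le_mulr_ln u0 v0; have := subr_le_mulr_ln u1' v1'.
move: (u * ln (u / v)) ((1 - u) * _) => A B hB hA.
move: (ln (v / p)) (ln ((1 - v) / (1 - p))) => x y.
rewrite -subr_ge0.
rewrite (_ : _ - _ = 2^-1 * (A + B)); last by field.
by rewrite mulr_ge0//; lra.
Qed.

Lemma rate_pp p : 0 < p < 1 -> rate p p = 0.
Proof.
move=> /andP[p0 p1]; rewrite /rate !divff ?lt0r_neq0 ?subr_gt0//.
by rewrite ln1 !mulr0 addr0 mulr0.
Qed.

Lemma rate_ge0 p u : 0 < p < 1 -> 0 <= u <= 1 -> 0 <= rate p u.
Proof.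
move=> p01 u01; have := rate_tangent p01 u01 p01.
rewrite rate_pp// /rate_slope !divff; first by rewrite subrr mulr0 mul0r addr0.
all: by case/andP: p01 => p0 p1; rewrite lt0r_neq0 ?subr_gt0.
Qed.

(** A combination of two instances of [rate_tangent] at the intermediate
    point. *)
Lemma rate_convex p u c s : 0 < p < 1 -> 0 <= u <= 1 -> 0 <= c <= 1 ->
  0 <= s <= 1 -> 0 < (1 - s) * u + s * c < 1 ->
  rate p ((1 - s) * u + s * c) <= (1 - s) * rate p u + s * rate p c.
Proof.
move=> p01 u01 c01 /andP[s0 s1] v01.
have s1' : 0 <= 1 - s by lra.
have := ler_wpM2l s1' (rate_tangent p01 u01 v01).
have := ler_wpM2l s0 (rate_tangent p01 c01 v01).
set v := (1 - s) * u + s * c; set r := rate p v; set d := rate_slope p v.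
have -> : s * (r + d * (c - v)) = s * r + (1 - s) * (d * (v - u)).
  by rewrite /v; ring.
have -> : (1 - s) * (r + d * (u - v)) = r - s * r - (1 - s) * (d * (v - u)).
  by ring.
lra.
Qed.

Lemma rate_bounded p u : 0 < p < 1 -> 0 <= u <= 1 ->
  rate p u <= 2^-1 * (- ln p - ln (1 - p)).
Proof.
move=> /andP[p0 p1] /andP[u0 u1].
have key (w q : R) : 0 < q -> q < 1 -> 0 <= w -> w <= 1 -> w * ln (w / q) <= - ln q.
  move=> q0 q1 w0 w1; have [->|wn0] := eqVneq w 0.
    by rewrite mul0r oppr_ge0 ln_le0// ltW.
  have w_gt0 : 0 < w by rewrite lt_neqAle eq_sym wn0.
  rewrite ln_div// mulrBr.
  have lw : ln w <= 0 by exact: ln_le0.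
  have lq : ln q <= 0 by apply: ln_le0; exact: ltW.
  nra.
rewrite /rate ler_pM2l//.
have := key u p p0 p1 u0 u1; have := key (1 - u) (1 - p).
by rewrite !subr_gt0 subr_ge0 => /(_ p1); lra.
Qed.

Lemma measurable_rate p : measurable_fun setT (rate p).
Proof.
apply: measurable_funM => //; apply: measurable_funD.
  apply: measurable_funM => //.
  apply: (@measurableT_comp _ _ _ _ _ _ (@ln R)) => //.
  exact: measurable_funM.
apply: measurable_funM; first exact: measurable_funB.
apply: (@measurableT_comp _ _ _ _ _ _ (@ln R)) => //.
by apply: measurable_funM => //; exact: measurable_funB.
Qed.

Lemma bounded_measurable_rate d (X : measurableType d) (f : X -> R) p :
  0 < p < 1 -> measurable_fun setT f -> (forall x, 0 <= f x <= 1) ->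
  bounded_measurable (fun x => rate p (f x)).
Proof.
move=> p01 mf f01; split; first exact: (measurableT_comp (measurable_rate p)).
exists (2^-1 * (- ln p - ln (1 - p))) => x.
by rewrite ger0_norm ?rate_bounded ?rate_ge0.
Qed.

Lemma ln_ratio_bounded b (q : R) : 0 < b -> 0 < q -> exists2 C, 0 <= C &
  forall w, b <= w <= 1 - b -> `|ln (w / q)| <= C.
Proof.
move=> b0 q0; exists (`|ln (b / q)| + `|ln ((1 - b) / q)|); first exact: addr_ge0.
move=> w /andP[bw wb]; have w0 : 0 < w by lra.
have b1 : 0 < 1 - b by lra.
have l1 : ln (b / q) <= ln (w / q).
  by rewrite ler_ln ?posrE ?divr_gt0// ler_pM2r// invr_gt0.
have l2 : ln (w / q) <= ln ((1 - b) / q).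
  by rewrite ler_ln ?posrE ?divr_gt0// ler_pM2r// invr_gt0.
rewrite ler_norml; apply/andP; split.
  have := ler_norm (- ln (b / q)); rewrite normrN.
  have := normr_ge0 (ln ((1 - b) / q)); lra.
have := ler_norm (ln ((1 - b) / q)); have := normr_ge0 (ln (b / q)); lra.
Qed.

Lemma rate_slope_bounded p b : 0 < p < 1 -> 0 < b -> exists2 C, 0 <= C &
  forall u, b <= u <= 1 - b -> `|rate_slope p u| <= C.
Proof.
move=> /andP[p0 p1] b0; have p1' : 0 < 1 - p by rewrite subr_gt0.
have [C C0 hC] := ln_ratio_bounded b0 p0.
have [D D0 hD] := ln_ratio_bounded b0 p1'.
exists (2^-1 * (C + D)) => [|u ub]; first by rewrite mulr_ge0// addr_ge0.
rewrite /rate_slope normrM gtr0_norm// ler_pM2l//.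
apply: (le_trans (ler_normB _ _)); apply: lerD; first exact: hC.
by apply: hD; lra.
Qed.

(** The tangent inequality bounds increments by the slope, which is bounded away
    from 0 and 1. *)
Lemma rate_lipschitz p b : 0 < p < 1 -> 0 < b -> exists2 C, 0 <= C &
  forall u v, b <= u <= 1 - b -> b <= v <= 1 - b ->
    rate p u - rate p v <= C * `|u - v|.
Proof.
move=> p01 b0; have [C C0 hC] := rate_slope_bounded p01 b0.
exists C => // u v ub vb.
have u01 : 0 < u < 1 by lra.
have v01 : 0 <= v <= 1 by lra.
have := rate_tangent p01 v01 u01.
have := ler_norm (rate_slope p u * (u - v)); rewrite normrM.
have := ler_wpM2r (normr_ge0 (u - v)) (hC u ub).
rewrite -opprB mulrN opprB; lra.
Qed.

End Rate.

(** * Step graphons *)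

Section MatrixGraphons.
Variable R : realType.
Local Notation mu := (@lebesgue_measure R).
Local Notation cell := (@cell R _).

Definition step_graphon n (c : 'I_n -> 'I_n -> R) : R * R -> R := fun z =>
  \sum_(i < n) \sum_(j < n) c i j * \1_(cell i) z.1 * \1_(cell j) z.2.

Lemma graphon_ofE n (X : graph n) :
  @graphon_of R n X = step_graphon (fun i j => (Defs.adjacent X i j)%:R).
Proof. by []. Qed.

Section cells.
Variable n : nat.
Implicit Types (i j k : 'I_n) (x y : R).

Lemma cell_inj i j x : cell i x -> cell j x -> i = j.
Proof.
have n0 : 0 < n%:R :> R by rewrite ltr0n; case: i => m /=; exact: leq_ltn_trans.
rewrite /cell /= !in_itv/= => /andP[ix xi] /andP[jx xj].
apply: val_inj => /=.
have ij : (i < j.+1)%N.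
  rewrite -(ltr_nat R) -(ltr_pM2r (x := n%:R^-1)) ?invr_gt0//.
  exact: le_lt_trans xj.
have ji : (j < i.+1)%N.
  rewrite -(ltr_nat R) -(ltr_pM2r (x := n%:R^-1)) ?invr_gt0//.
  exact: le_lt_trans xi.
by apply/eqP; rewrite eqn_leq -ltnS ij -ltnS ji.
Qed.

(** The cells are half-open, so they cover [0, 1) and miss the point 1: formulas
    for step functions hold off a null set only. *)
Lemma cell_cover x : (0 < n)%N -> 0 <= x < 1 -> exists i, cell i x.
Proof.
move=> n0 /andP[x0 x1].
have n0' : 0 < n%:R :> R by rewrite ltr0n.
have nx0 : 0 <= n%:R * x by rewrite mulr_ge0// ltW.
have /andP[tl tu] := truncn_itv nx0.
have tn : (Num.truncn (n%:R * x) < n)%N.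
  rewrite -(ltr_nat R); apply: (le_lt_trans tl).
  by rewrite -[ltRHS]mulr1 ltr_pM2l.
exists (Ordinal tn); rewrite /cell /= in_itv/=.
by rewrite ler_pdivrMr// ltr_pdivlMr// -[x * _]mulrC tl tu.
Qed.

Lemma cell_sub01 i x : cell i x -> 0 <= x < 1.
Proof.
have n0 : 0 < n%:R :> R by rewrite ltr0n; case: i => m /=; exact: leq_ltn_trans.
rewrite /cell /= in_itv/= => /andP[ix xi].
rewrite (le_trans _ ix) ?divr_ge0//= (lt_le_trans xi)//.
by rewrite ler_pdivrMr// mul1r ler_nat.
Qed.

Lemma measurable_cell i : measurable (cell i).
Proof. exact: measurable_itv. Qed.

Lemma int01_cell i : int01 (\1_(cell i)) = n%:R^-1.
Proof.
have n0 : 0 < n%:R :> R by rewrite ltr0n; case: i => m /=; exact: leq_ltn_trans.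
rewrite int01E /Rintegral integral_indic//; last exact: measurable_cell.
rewrite setIidl; last first.
  move=> x /cell_sub01 /andP[x0 x1]; rewrite /= in_itv/= x0; exact: ltW.
rewrite /Defs.cell /= lebesgue_measure_itv/= lte_fin ltr_pM2r ?invr_gt0// ltr_nat ltnS leqnn.
by rewrite -EFinB/= -mulrBl -natrB// subSnn mul1r.
Qed.

(** The point 1 is negligible. *)
Lemma int01_ext_co (h k : R -> R) :
  bounded_measurable h -> bounded_measurable k ->
  (forall x, 0 <= x < 1 -> h x = k x) -> int01 h = int01 k.
Proof.
move=> bh bk hk.
have co (f : R -> R) : bounded_measurable f ->
    int01 f = \int[mu]_(x in `[0, 1[) f x.
  move=> bf; rewrite int01E; apply/esym/Rintegral_itv_bndo_bndc.
  apply: (@integrableS _ _ _ mu `[0, 1]%classic) => //.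
    by move=> x /=; rewrite !in_itv/= => /andP[-> /ltW].
  exact: bounded_measurable_integrable.
rewrite (co _ bh) (co _ bk); apply: eq_Rintegral => x.
by rewrite inE/= in_itv/=; exact: hk.
Qed.

Lemma int01_step (h : R -> R) (v : 'I_n -> R) : (0 < n)%N ->
  bounded_measurable h -> (forall i x, cell i x -> h x = v i) ->
  int01 h = (\sum_i v i) / n%:R.
Proof.
move=> n0 bh hv.
have bI i : bounded_measurable (fun x => v i * \1_(cell i) x).
  apply: bounded_measurableM; first exact: bounded_measurable_cst.
  by apply: bounded_measurable_indic; exact: measurable_cell.
transitivity (int01 (fun x => \sum_i v i * \1_(cell i) x)).
  apply: int01_ext_co => //; first exact: bounded_measurable_sum.
  move=> x /(cell_cover n0)[i ix]; rewrite (hv _ _ ix) (bigD1 i)//= big1.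
    by rewrite indicE mem_set// mulr1 addr0.
  move=> j ji; rewrite indicE memNset ?mulr0// => jx.
  by move/eqP: ji; apply; exact: cell_inj jx ix.
rewrite int01_sum// mulr_suml; apply: eq_bigr => i _.
rewrite int01Z ?int01_cell//.
by apply: bounded_measurable_indic; exact: measurable_cell.
Qed.

End cells.

Section step.
Variable n : nat.
Hypothesis n0 : (0 < n)%N.
Implicit Type c : 'I_n -> 'I_n -> R.

Lemma step_graphonE c i j x y : cell i x -> cell j y ->
  step_graphon c (x, y) = c i j.
Proof.
move=> ix jy; rewrite /step_graphon/= (bigD1 i)//= (bigD1 j)//= !indicE.
rewrite !mem_set// !mulr1 !big1 ?addr0// => [k ki|k kj].
  rewrite big1// => l _; rewrite indicE memNset ?mulr0 ?mul0r// => kx.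
  by move/eqP: ki; apply; exact: cell_inj kx ix.
rewrite !indicE (@memNset _ (cell k) y) ?mulr0// => ky.
by move/eqP: kj; apply; exact: cell_inj ky jy.
Qed.

Lemma step_graphon_out c x y : ~~ (0 <= x < 1) || ~~ (0 <= y < 1) ->
  step_graphon c (x, y) = 0.
Proof.
move=> xy; rewrite /step_graphon big1// => i _; rewrite big1// => j _ /=.
rewrite !indicE; case/orP: xy => xy.
  by rewrite (@memNset _ (cell i) x) ?mulr0 ?mul0r// => /cell_sub01; exact/negP.
by rewrite (@memNset _ (cell j) y) ?mulr0// => /cell_sub01; exact/negP.
Qed.

Lemma step_graphon_ind c (P : R -> Prop) : P 0 -> (forall i j, P (c i j)) ->
  forall z, P (step_graphon c z).
Proof.
move=> P0 Pc [x y].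
have [x01|nx] := boolP (0 <= x < 1); last first.
  by rewrite step_graphon_out ?nx.
have [y01|ny] := boolP (0 <= y < 1); last first.
  by rewrite step_graphon_out ?ny ?orbT.
have [i ix] := cell_cover n0 x01; have [j jy] := cell_cover n0 y01.
by rewrite (step_graphonE c ix jy).
Qed.

Lemma measurable_step_graphon c : measurable_fun setT (step_graphon c).
Proof.
have mI i : measurable_fun setT (\1_(cell i) : R -> R).
  by apply: measurable_indic; exact: measurable_cell.
apply: measurable_sum => i; apply: measurable_sum => j.
apply: measurable_funM; first apply: measurable_funM => //.
  exact: (@measurableT_comp _ _ _ _ _ _ (\1_(cell i) : R -> R) _ fst).
exact: (@measurableT_comp _ _ _ _ _ _ (\1_(cell j) : R -> R) _ snd).
Qed.

Lemma bounded_measurable_step_graphon c : bounded_measurable (step_graphon c).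
Proof.
split; first exact: measurable_step_graphon.
exists (\sum_i \sum_j `|c i j|).
apply: (step_graphon_ind (P := fun r => `|r| <= _)).
  by rewrite normr0; apply: sumr_ge0 => i' _; apply: sumr_ge0.
move=> i j; rewrite (bigD1 i)//= (bigD1 j)//= -addrA ler_wpDr// addr_ge0//.
  exact: sumr_ge0.
by apply: sumr_ge0 => i' _; apply: sumr_ge0.
Qed.

Lemma step_graphon_sym c : (forall i j, c i j = c j i) ->
  forall x y, step_graphon c (x, y) = step_graphon c (y, x).
Proof.
move=> cs x y; rewrite /step_graphon/= exchange_big/=.
by apply: eq_bigr => i _; apply: eq_bigr => j _; rewrite cs mulrAC.
Qed.

Lemma graphons_step_graphon c : (forall i j, c i j = c j i) ->
  (forall i j, 0 <= c i j <= 1) -> graphons (step_graphon c).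
Proof.
move=> cs c01; split.
- exact: measurable_funTS (measurable_step_graphon c).
- by move=> x y _ _; exact: step_graphon_sym.
- move=> x y _ _; move: (x, y).
  by apply: (step_graphon_ind (P := fun r => 0 <= r <= 1)); rewrite ?lexx ?ler01.
Qed.

Lemma int2_step (h : R * R -> R) c : bounded_measurable h ->
  (forall i j x y, cell i x -> cell j y -> h (x, y) = c i j) ->
  int2 h = (\sum_i \sum_j c i j) / n%:R ^+ 2.
Proof.
move=> bh hc; rewrite /int2.
rewrite (int01_step (v := fun i => (\sum_j c i j) / n%:R))//.
- by rewrite -mulr_suml -mulrA -invfM -expr2.
- exact: bounded_measurable_int01.
- move=> i x ix; apply: int01_step => //; first exact: bounded_measurable_slice.
  by move=> j y jy; exact: hc.
Qed.

Lemma edge_density_step c :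
  edge_density (step_graphon c) = (\sum_i \sum_j c i j) / n%:R ^+ 2.
Proof.
rewrite edge_densityE; apply: int2_step.
  exact: bounded_measurable_step_graphon.
by move=> i j x y; exact: step_graphonE.
Qed.

Lemma triangle_density_step c : triangle_density (step_graphon c) =
  (\sum_i \sum_j \sum_k c i j * c j k * c i k) / n%:R ^+ 3.
Proof.
have b := bounded_measurable_step_graphon c.
have bT := triangle_integrand_measurable b b b.
rewrite triangle_densityE int3E.
rewrite (int2_step (c := fun i j => (\sum_k c i j * c j k * c i k) / n%:R)).
- rewrite [in RHS](exprS _ 2) [in RHS]invfM [RHS]mulrA; congr (_ * _); rewrite mulr_suml.
  by apply: eq_bigr => i _; rewrite mulr_suml.
- exact: (bounded_measurable_int01 bT).
- move=> i j x y ix jy; apply: int01_step => //.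
    exact: (bounded_measurable_slice (x, y) bT).
  by move=> k z kz; rewrite (step_graphonE _ ix jy) (step_graphonE _ jy kz) (step_graphonE _ ix kz).
Qed.

Lemma graphon_rate_step p c : 0 < p < 1 -> (forall i j, 0 <= c i j <= 1) ->
  graphon_rate p (step_graphon c) = (\sum_i \sum_j rate p (c i j)) / n%:R ^+ 2.
Proof.
move=> p01 c01; rewrite graphon_rateE; apply: int2_step.
  apply: bounded_measurable_rate => //; first exact: measurable_step_graphon.
  by apply: (step_graphon_ind (P := fun r => 0 <= r <= 1)); rewrite ?lexx ?ler01.
by move=> i j x y ix jy; rewrite (step_graphonE _ ix jy).
Qed.

End step.

End MatrixGraphons.

(** * Cut norm and decomposition into rectangles *)

Section CutNorm.
Variables (R : realType) (n : nat).
Implicit Types (M N : 'I_n -> 'I_n -> R) (S T : {set 'I_n}).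

Definition cut_sum M S T : R := \sum_(i in S) \sum_(j in T) M i j.

(** A linear function of weights in [0, 1] is extremal at a vertex of the cube,
    here the indicator of the set where the coefficients are positive. *)
Lemma sum_weight_le (a u : 'I_n -> R) B :
  (forall S : {set 'I_n}, `|\sum_(i in S) a i| <= B) -> (forall i, 0 <= u i <= 1) ->
  `|\sum_i a i * u i| <= B.
Proof.
have key (b : 'I_n -> R) : (forall S : {set 'I_n}, `|\sum_(i in S) b i| <= B) ->
    (forall i, 0 <= u i <= 1) -> \sum_i b i * u i <= B.
  move=> bB u01; apply: (le_trans _ (bB [set i | 0 < b i]%SET)).
  apply: (le_trans _ (ler_norm _)).
  rewrite [leLHS](bigID (fun i => 0 < b i))/=.
  rewrite -[leRHS]addr0; apply: lerD.
    under [leRHS]eq_bigl do rewrite inE.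
    apply: ler_sum => i bi; have /andP[u0 u1] := u01 i.
    by rewrite ler_piMr// ltW.
  apply: sumr_le0 => i; rewrite -leNgt => bi; have /andP[u0 u1] := u01 i.
  exact: mulr_le0_ge0.
move=> aB u01; rewrite ler_norml lerNl; apply/andP; split; last exact: key.
rewrite -sumrN; under eq_bigr do rewrite -mulNr.
by apply: key => // S; rewrite sumrN normrN.
Qed.

Lemma cut_bilinear M B (u v : 'I_n -> R) :
  (forall S T, `|cut_sum M S T| <= B) ->
  (forall i, 0 <= u i <= 1) -> (forall i, 0 <= v i <= 1) ->
  `|\sum_i \sum_j M i j * u i * v j| <= B.
Proof.
move=> MB u01 v01.
under eq_bigr => i _.
  under eq_bigr => j _ do rewrite mulrAC.
  rewrite -mulr_suml; over.
apply: sum_weight_le => // S; rewrite exchange_big/=.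
under eq_bigr => i _ do rewrite -mulr_suml.
by apply: sum_weight_le => // T; rewrite exchange_big; exact: MB.
Qed.

Definition triangle_sum M : R := \sum_i \sum_j \sum_k M i j * M j k * M i k.

(** Replacing [M] by [N] one factor at a time leaves a sum over one vertex of
    bilinear forms of [M - N] with weights in [0, 1]. *)
Lemma triangle_sum_cut M N B :
  (forall i j, 0 <= M i j <= 1) -> (forall i j, 0 <= N i j <= 1) ->
  (forall S T, `|cut_sum (fun i j => M i j - N i j) S T| <= B) ->
  `|triangle_sum M - triangle_sum N| <= (3 * n)%:R * B.
Proof.
move=> M01 N01 cB.
have sumB (F : 'I_n -> R) : (forall i, `|F i| <= B) -> `|\sum_i F i| <= n%:R * B.
  move=> FB; apply: (le_trans (ler_norm_sum _ _ _)).
  apply: (le_trans (ler_sum _ (fun i _ => FB i))).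
  by rewrite sumr_const card_ord mulr_natl.
have -> : triangle_sum M - triangle_sum N =
    \sum_k \sum_i \sum_j (M i j - N i j) * M i k * M j k +
    (\sum_i \sum_j \sum_k (M j k - N j k) * N i j * M i k +
     \sum_j \sum_i \sum_k (M i k - N i k) * N i j * N j k).
  rewrite /triangle_sum.
  rewrite [X in X + (_ + _)]exchange_big/= [X in _ + (_ + X)]exchange_big/=.
  under [X in X + (_ + _)]eq_bigr do rewrite exchange_big/=.
  rewrite -sumrB -!big_split/=; apply: eq_bigr => i _.
  rewrite -sumrB -!big_split/=; apply: eq_bigr => j _.
  rewrite -sumrB -!big_split/=; apply: eq_bigr => k _.
  by ring.
rewrite natrM -mulrA (_ : 3 * (n%:R * B) = n%:R * B + (n%:R * B + n%:R * B)); last by ring.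
apply: (le_trans (ler_normD _ _)); apply: lerD.
  by apply: sumB => k; exact: cut_bilinear.
apply: (le_trans (ler_normD _ _)); apply: lerD.
  by apply: sumB => i; exact: cut_bilinear.
by apply: sumB => j; exact: cut_bilinear.
Qed.

Definition energy M : R := \sum_i \sum_j M i j ^+ 2.

(** [None] allows to pad a list of rectangles to a prescribed length, which
    makes decompositions of bounded length a finite type. *)
Definition block := option (bool * {set 'I_n} * {set 'I_n}).

Definition block_mx (eps : R) (o : block) (i j : 'I_n) : R :=
  if o is Some (s, U, V) then
    (if s then eps else - eps) * (i \in U)%:R * (j \in V)%:R else 0.

Definition blocks_mx eps (l : seq block) (i j : 'I_n) : R :=
  \sum_(o <- l) block_mx eps o i j.

(** Expanding the square, the cross term gains [2 * eps * (eps * n ^ 2)] and the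
    square of the rectangle costs at most [eps ^ 2 * n ^ 2].  A coefficient of
    fixed modulus thus suffices, and no choice of coefficients has to be
    recorded. *)
Lemma energy_subblock M eps s S T :
  eps * n%:R ^+ 2 <= (if s then 1 else - 1) * cut_sum M S T -> 0 <= eps ->
  energy (fun i j => M i j - block_mx eps (Some (s, S, T)) i j) <=
  energy M - eps ^+ 2 * n%:R ^+ 2.
Proof.
move=> hcut eps0.
pose sg : R := if s then 1 else -1.
have -> : energy (fun i j => M i j - block_mx eps (Some (s, S, T)) i j) =
   energy M - 2 * (eps * (sg * cut_sum M S T)) + eps ^+ 2 * (#|S| * #|T|)%:R.
  have -> : cut_sum M S T = \sum_i \sum_j M i j * (i \in S)%:R * (j \in T)%:R.
    rewrite /cut_sum big_mkcond/=; apply: eq_bigr => i _.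
    case: ifPn => iS; last by rewrite big1// => j _; rewrite mulr0 mul0r.
    rewrite big_mkcond/=; apply: eq_bigr => j _; rewrite mulr1.
    by case: ifPn => jT; rewrite ?mulr1 ?mulr0.
  have -> : (#|S| * #|T|)%:R = \sum_i \sum_j (i \in S)%:R * (j \in T)%:R :> R.
    under eq_bigr do rewrite -mulr_sumr.
    have cardE (U : {set 'I_n}) : \sum_i (i \in U)%:R = #|U|%:R :> R.
      by rewrite -sum1_card natr_sum [RHS]big_mkcond; apply: eq_bigr => i _; case: ifP.
    by rewrite -mulr_suml natrM !cardE.
  rewrite /energy !mulr_sumr -sumrN -!big_split/=; apply: eq_bigr => i _.
  rewrite !mulr_sumr -sumrN -!big_split/=; apply: eq_bigr => j _.
  rewrite /sg; case: s {hcut sg}; case: (i \in S); case: (j \in T); rewrite /= ?(mulr1n, mulr0n); ring.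
have : eps ^+ 2 * (#|S| * #|T|)%:R <= eps ^+ 2 * n%:R ^+ 2.
  rewrite ler_wpM2l ?sqr_ge0// -natrX ler_nat expnS expn1 leq_mul//.
    by rewrite -[leqRHS](card_ord n) max_card.
  by rewrite -[leqRHS](card_ord n) max_card.
have := ler_wpM2l eps0 hcut; rewrite -/sg; lra.
Qed.

(** As long as some rectangle violates the cut bound, subtracting it decreases
    the energy by a fixed amount. *)
Lemma greedy_blocks M eps K : 0 <= eps -> (forall i j, 0 <= M i j <= 1) ->
  exists l : K.-tuple block,
    (forall S T, `|cut_sum (fun i j => M i j - blocks_mx eps l i j) S T| <=
       eps * n%:R ^+ 2) \/
    energy (fun i j => M i j - blocks_mx eps l i j) <=
      n%:R ^+ 2 - K%:R * (eps ^+ 2 * n%:R ^+ 2).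
Proof.
move=> eps0 M01; elim: K => [|K [l ih]].
  exists [tuple]; right; rewrite mul0r subr0 /energy.
  apply: (@le_trans _ _ (\sum_(i < n) \sum_(j < n) 1)).
    apply: ler_sum => i _; apply: ler_sum => j _.
    rewrite /blocks_mx big_nil subr0; have /andP[M0 M1] := M01 i j.
    by rewrite exprn_ile1.
  by rewrite !sumr_const !card_ord -mulrnA -natrX mulnn.
have Econs (o : block) : (fun i j => M i j - blocks_mx eps [tuple of o :: l] i j) =
    (fun i j => (M i j - blocks_mx eps l i j) - block_mx eps o i j).
  apply/funext => i; apply/funext => j.
  by rewrite /blocks_mx big_cons opprD addrA addrAC.
have [good|bad] := pselect (forall S T,
    `|cut_sum (fun i j => M i j - blocks_mx eps l i j) S T| <= eps * n%:R ^+ 2).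
  exists [tuple of None :: l]; left => S T; rewrite Econs.
  have -> : (fun i j => (M i j - blocks_mx eps l i j) - block_mx eps None i j) =
            (fun i j => M i j - blocks_mx eps l i j).
    by apply/funext => i; apply/funext => j; rewrite subr0.
  exact: good.
case: ih => [//|ih].
move: bad => /existsNP[S] /existsNP[T] /negP; rewrite -ltNge => bad.
pose s := 0 <= cut_sum (fun i j => M i j - blocks_mx eps l i j) S T.
exists [tuple of Some (s, S, T) :: l]; right; rewrite Econs.
apply: (le_trans (energy_subblock _ eps0)).
  rewrite /s; case: ifPn => [c0|c0]; apply: ltW.
    by rewrite mul1r -[ltRHS]ger0_norm.
  by rewrite mulN1r -[ltRHS]ltr0_norm// ltNge.
by rewrite -(natr1 K) mulrDl mul1r opprD addrA lerD2r.
Qed.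

(** The energy starts at [n ^ 2] at most and cannot become negative, so the greedy
    procedure stops before [K] steps.  This is the weak regularity lemma in the
    form of Frieze and Kannan. *)
Lemma block_approx M eps K : 0 < eps -> 1 < K%:R * eps ^+ 2 -> (0 < n)%N ->
  (forall i j, 0 <= M i j <= 1) ->
  exists l : K.-tuple block, forall S T,
    `|cut_sum (fun i j => M i j - blocks_mx eps l i j) S T| <= eps * n%:R ^+ 2.
Proof.
move=> eps0 Keps n0 M01.
have [l [good|]] := greedy_blocks K (ltW eps0) M01; first by exists l.
move=> le; have : 0 <= energy (fun i j => M i j - blocks_mx eps l i j).
  by apply: sumr_ge0 => i _; apply: sumr_ge0 => j _; exact: sqr_ge0.
move=> /le_trans /(_ le); rewrite mulrA -{1}[n%:R ^+ 2]mul1r -mulrBl.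
rewrite pmulr_lge0 ?exprn_gt0 ?ltr0n// subr_ge0 => h.
by have := lt_le_trans Keps h; rewrite ltxx.
Qed.

(** The exponent is linear in [n], hence negligible against [n ^ 2]. *)
Lemma card_block_tuple K : (#|{: K.-tuple block}| <= 2 ^ ((2 * n + 2) * K))%N.
Proof.
have card_set : #|{set 'I_n}| = (2 ^ n)%N.
  by rewrite -cardsT -powersetT card_powerset cardsT card_ord.
case: K => [|K]; first by rewrite card_tuple expn0 muln0 expn0.
rewrite card_tuple expnM leq_exp2r// card_option !card_prod card_bool card_set.
have -> : (2 ^ (2 * n + 2) = 4 * (2 ^ n * 2 ^ n))%N.
  by rewrite expnD mul2n -addnn expnD mulnC.
rewrite -mulnA; have : (0 < 2 ^ n * 2 ^ n)%N by rewrite muln_gt0 expn_gt0.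
by move: (2 ^ n * 2 ^ n)%N => m; lia.
Qed.

End CutNorm.

(** * Product Bernoulli laws *)

Section ProductBernoulli.
Variables (R : realType) (E : finType).
Implicit Types (y : E -> R) (X : {ffun E -> bool}) (p : R).

Definition bernoulli_mass y X : R := \prod_e (if X e then y e else 1 - y e).

Lemma sum_prod_ffun (F : E -> bool -> R) :
  \sum_(X : {ffun E -> bool}) \prod_e F e (X e) =
  \prod_e (F e true + F e false).
Proof.
rewrite -bigA_distr_bigA/=; apply: eq_bigr => e _.
by rewrite big_bool.
Qed.

Lemma bernoulli_mass_sum y : \sum_X bernoulli_mass y X = 1.
Proof.
rewrite (sum_prod_ffun (fun e b => if b then y e else 1 - y e)).
by rewrite big1// => e _; rewrite addrC subrK.
Qed.

Lemma bernoulli_mass_ge0 y X : (forall e, 0 <= y e <= 1) ->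
  0 <= bernoulli_mass y X.
Proof.
move=> y01; apply: prodr_ge0 => e _; have /andP[y0 y1] := y01 e.
by case: ifP; rewrite ?subr_ge0.
Qed.

Lemma bernoulli_mass_gt0 y X : (forall e, 0 < y e < 1) ->
  0 < bernoulli_mass y X.
Proof.
move=> y01; apply: prodr_gt0 => e _; have /andP[y0 y1] := y01 e.
by case: ifP; rewrite ?subr_gt0.
Qed.

(** The edges of [S] are independent. *)
Lemma bernoulli_mass_sum_set y (S : {set E}) : \sum_X bernoulli_mass y X *
  \prod_(e in S) (X e)%:R = \prod_(e in S) y e.
Proof.
transitivity (\sum_(X : {ffun E -> bool}) \prod_e
    ((if X e then y e else 1 - y e) * (if e \in S then (X e)%:R else 1))).
  by apply: eq_bigr => X _; rewrite [\prod_(e in S) _]big_mkcond/= -big_split.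
rewrite (sum_prod_ffun (fun e b => (if b then y e else 1 - y e) *
   (if e \in S then b%:R else 1))) [RHS]big_mkcond/=; apply: eq_bigr => e _.
by case: ifPn => _; rewrite !(mulr1, mulr0, addr0)// addrC subrK.
Qed.

Definition loglik p y X : R :=
  \sum_e (if X e then ln (y e / p) else ln ((1 - y e) / (1 - p))).

(** The condition on [y] only concerns the outcomes present in [X], so that it
    covers means equal to 0 or 1. *)
Lemma bernoulli_mass_loglik p y X : 0 < p < 1 -> (forall e, if X e then 0 < y e else y e < 1) ->
  bernoulli_mass y X = bernoulli_mass (fun=> p) X * expR (loglik p y X).
Proof.
move=> /andP[p0 p1] yX; rewrite /loglik expR_sum -big_split/=.
apply: eq_bigr => e _; have := yX e; case: (X e) => ye.
  by rewrite lnK ?posrE ?divr_gt0// mulrC divfK// gt_eqF.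
have p1' : 0 < 1 - p by rewrite subr_gt0.
by rewrite lnK ?posrE ?divr_gt0 ?subr_gt0// mulrC divfK// gt_eqF.
Qed.

(** Let [nu] be the law conditioned on [A]; it has the same one-edge marginals as
    the product law of means [y].  The relative entropy of [nu] with respect to
    that product law is nonnegative, and the logarithms of the product densities
    average under [nu] to sums over single edges.  No independence is left in
    [nu], yet only its marginals enter the bound. *)
Lemma entropy_bound p (A : {set {ffun E -> bool}}) : 0 < p < 1 ->
  let PA := \sum_(X in A) bernoulli_mass (fun=> p) X in
  let y e := (\sum_(X in A) bernoulli_mass (fun=> p) X * (X e)%:R) / PA in
  0 < PA ->
  (forall e, 0 <= y e <= 1) /\ PA <= expR (- (2 * \sum_e rate p (y e))).
Proof.
move=> p01 PA y PA0; have /andP[p0 p1] := p01.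
set P := bernoulli_mass (fun=> p).
have P0 X : 0 < P X by exact: bernoulli_mass_gt0.
pose nu X := P X / PA.
have nu0 X : 0 < nu X by rewrite divr_gt0.
have nuA : \sum_(X in A) nu X = 1 by rewrite -mulr_suml divff// gt_eqF.
have yE e : y e = \sum_(X in A) nu X * (X e)%:R.
  by rewrite /y mulr_suml; apply: eq_bigr => X _; rewrite mulrAC.
have y1E e : 1 - y e = \sum_(X in A) nu X * (~~ X e)%:R.
  rewrite yE -[X in X - _]nuA -sumrB; apply: eq_bigr => X _.
  by case: (X e); rewrite /= ?(mulr1, mulr0, subr0, subrr).
have y01 e : 0 <= y e <= 1.
  apply/andP; split; [rewrite yE|rewrite -subr_ge0 y1E]; apply: sumr_ge0 => X _;
    by rewrite mulr_ge0// ltW.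
split => //.
have yX X : X \in A -> forall e, if X e then 0 < y e else y e < 1.
  move=> XA e; case: ifPn => Xe.
    rewrite yE (bigD1 X)//= Xe mulr1 ltr_pwDl// sumr_ge0// => Y _.
    by rewrite mulr_ge0// ltW.
  rewrite -subr_gt0 y1E (bigD1 X)//= Xe mulr1 ltr_pwDl// sumr_ge0// => Y _.
  by rewrite mulr_ge0// ltW.
have ll : \sum_(X in A) nu X * loglik p y X = 2 * \sum_e rate p (y e).
  rewrite /loglik; under eq_bigr do rewrite mulr_sumr.
  rewrite exchange_big mulr_sumr/=; apply: eq_bigr => e _.
  rewrite /rate mulrA divff// mul1r.
  move: (ln (y e / p)) (ln ((1 - y e) / (1 - p))) => a b.
  rewrite y1E yE !mulr_suml -big_split/=; apply: eq_bigr => X _.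
  by case: (X e); rewrite /= !(mulr1, mulr0, mul0r, addr0, add0r).
have le0 : ln PA + 2 * \sum_e rate p (y e) <= 0.
  rewrite -ll -[ln PA]mul1r -nuA mulr_suml -big_split/=.
  apply: (@le_trans _ _ (\sum_(X in A) (bernoulli_mass y X - nu X))).
    apply: ler_sum => X XA; rewrite -mulrDr.
    rewrite (bernoulli_mass_loglik p01 (yX X XA)) -/P.
    have -> : P X * expR (loglik p y X) = nu X * expR (ln PA + loglik p y X).
      by rewrite expRD lnK ?posrE// mulrA divfK// gt_eqF.
    rewrite -[X in _ - X]mulr1 -mulrBr ler_pM2l// lerBrDl.
    exact: expR_ge1Dx.
  rewrite sumrB nuA subr_le0 -(bernoulli_mass_sum y) [leRHS](bigID (mem A))/=.
  rewrite lerDl sumr_ge0// => X _; exact: bernoulli_mass_ge0.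
by rewrite -[leLHS]lnK ?posrE// ler_expR; lra.
Qed.

Lemma expR_le_quadratic (x : R) : x <= 2^-1 -> expR x <= 1 + x + 2 * x ^+ 2.
Proof.
move=> x2; have := expR_ge1Dx (- x); rewrite expRN => h.
have x1 : 0 < 1 - x by lra.
apply: (@le_trans _ _ (1 - x)^-1).
  by rewrite -[leLHS]invrK lef_pV2 ?posrE ?invr_gt0 ?expR_gt0.
rewrite -[leLHS]mul1r ler_pdivrMr//.
have -> : (1 + x + 2 * x ^+ 2) * (1 - x) = 1 + x ^+ 2 * (1 - 2 * x) by ring.
by rewrite lerDl mulr_ge0 ?sqr_ge0//; lra.
Qed.

(** Exponential Markov inequality with parameter [s = eps / (4 * C ^ 2)].  Each
    factor of the exponential moment is at most [1 + 2 * (s * C) ^ 2] because the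
    linear term is centred, and [eps <= 2 * C] makes [s * C <= 1 / 2]. *)
Lemma chernoff y (W : E -> bool -> R) C eps : 0 < C -> 0 < eps <= 2 * C ->
  (forall e, 0 <= y e <= 1) -> (forall e b, `|W e b| <= C) ->
  (forall e, y e * W e true + (1 - y e) * W e false = 0) ->
  \sum_X bernoulli_mass y X * (eps * #|E|%:R <= \sum_e W e (X e))%R%:R <=
  expR (- (eps ^+ 2 / (8 * C ^+ 2) * #|E|%:R)).
Proof.
move=> C0 /andP[eps0 epsC] y01 WC Wc.
pose s := eps / (4 * C ^+ 2).
have C2 : 0 < C ^+ 2 by rewrite exprn_gt0.
have s0 : 0 < s by rewrite divr_gt0// mulr_gt0.
have sC : s * C <= 2^-1.
  rewrite /s expr2 (_ : eps / _ * C = eps / (4 * C)); last first.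
    by field; rewrite gt_eqF.
  by rewrite ler_pdivrMr ?mulr_gt0//; lra.
apply: (@le_trans _ _ (expR (- (s * (eps * #|E|%:R))) *
   \sum_X bernoulli_mass y X * expR (s * \sum_e W e (X e)))).
  rewrite mulr_sumr; apply: ler_sum => X _.
  rewrite mulrCA; apply: ler_wpM2l; first exact: bernoulli_mass_ge0.
  rewrite -expRD; case: (leP (eps * #|E|%:R)) => h; last exact: expR_ge0.
  rewrite mulr1n.
  have := expR_ge1Dx (- (s * (eps * #|E|%:R)) + s * \sum_e W e (X e)).
  have := ler_wpM2l (ltW s0) h; lra.
have -> : \sum_X bernoulli_mass y X * expR (s * \sum_e W e (X e)) =
   \prod_e (y e * expR (s * W e true) + (1 - y e) * expR (s * W e false)).
  rewrite -(sum_prod_ffun (fun e b => (if b then y e else 1 - y e) * expR (s * W e b))).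
  by apply: eq_bigr => X _; rewrite mulr_sumr expR_sum -big_split.
have fac e : y e * expR (s * W e true) + (1 - y e) * expR (s * W e false) <=
    expR (2 * (s * C) ^+ 2).
  have /andP[y0 y1] := y01 e.
  have key b : expR (s * W e b) <= 1 + s * W e b + 2 * (s * C) ^+ 2.
    apply: (@le_trans _ _ (1 + s * W e b + 2 * (s * W e b) ^+ 2)).
      apply: expR_le_quadratic; apply: (le_trans _ sC).
      by apply: ler_wpM2l; [exact: ltW|exact: le_trans (ler_norm _) (WC e b)].
    rewrite lerD2l ler_pM2l// -[leLHS]real_normK ?num_real//.
    rewrite ler_pXn2r ?nnegrE ?normr_ge0//; last by rewrite mulr_ge0// ltW.
    by rewrite normrM gtr0_norm// ler_pM2l.
  apply: (le_trans _ (expR_ge1Dx _)).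
  have y1' : 0 <= 1 - y e by lra.
  have := ler_wpM2l y0 (key true); have := ler_wpM2l y1' (key false).
  have := congr1 (fun r => s * r) (Wc e); rewrite mulr0; nra.
apply: (@le_trans _ _ (expR (- (s * (eps * #|E|%:R))) * \prod_(e : E) expR (2 * (s * C) ^+ 2))).
  apply: ler_wpM2l; first exact: expR_ge0.
  apply: ler_prod => e _; rewrite fac andbT addr_ge0// mulr_ge0 ?expR_ge0//.
    by have /andP[] := y01 e.
  by have /andP[] := y01 e; rewrite subr_ge0.
rewrite prodr_const -expRM_natl -expRD ler_expR.
rewrite (_ : _ + _ = - (eps ^+ 2 / (8 * C ^+ 2) * #|E|%:R))//.
by rewrite /s; field; rewrite gt_eqF.
Qed.

End ProductBernoulli.

(** * Matrices of graphs *)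

Section EdgeMatrix.
Variables (R : realType) (n : nat).
Implicit Types (y : vertex_pair n -> R) (X : graph n) (i j : 'I_n).

(** The symmetric matrix with zero diagonal carried by a function on edges; at
    most one term is present.  Written as a sum it is visibly linear in [y]. *)
Definition edge_mx y i j : R :=
  \sum_(e : vertex_pair n | val e \in [:: (i, j); (j, i)]) y e.

Lemma edge_mx_sym y i j : edge_mx y i j = edge_mx y j i.
Proof. by apply: eq_bigl => e; rewrite !inE orbC. Qed.

Lemma edge_mx_val y e : edge_mx y (val e).1 (val e).2 = y e.
Proof.
rewrite /edge_mx (big_pred1 e)// => e'; rewrite !inE -surjective_pairing.
rewrite val_eqE; case: eqVneq => //= _; apply/negbTE/eqP => e'e.
have := valP e'; rewrite (e'e : val e' = _)/= ltnNge ltnW//; exact: valP e.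
Qed.

Lemma edge_mx_diag y i : edge_mx y i i = 0.
Proof.
rewrite /edge_mx big_pred0// => e; rewrite !inE orbb; apply/negbTE/eqP => ei.
by have := valP e; rewrite (ei : val e = _)/= ltnn.
Qed.

Lemma edge_mx_ind y (P : R -> Prop) : P 0 -> (forall e, P (y e)) ->
  forall i j, P (edge_mx y i j).
Proof.
move=> P0 Py i j; have [ij|ji|/val_inj ->] := ltngtP i j.
- by have := Py (Sub (i, j) ij); rewrite -edge_mx_val SubK.
- by have := Py (Sub (j, i) ji); rewrite edge_mx_sym -edge_mx_val SubK.
- by rewrite edge_mx_diag.
Qed.

Lemma edge_mx_adjacent X i j :
  (Defs.adjacent X i j)%:R = edge_mx (fun e => (X e)%:R) i j.
Proof.
have [/existsP[e /andP[Xe]]|noe] := boolP (Defs.adjacent X i j).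
  rewrite !inE => /orP[] /eqP eE.
    have [-> ->] : i = (val e).1 /\ j = (val e).2 by rewrite eE.
    by rewrite edge_mx_val Xe.
  have [-> ->] : i = (val e).2 /\ j = (val e).1 by rewrite eE.
  by rewrite edge_mx_sym edge_mx_val Xe.
rewrite /edge_mx big1// => e eij; case: (boolP (X e)) => // Xe.
by move/negP: noe; case; apply/existsP; exists e; rewrite Xe.
Qed.

Lemma sum_vertex_pair (G : 'I_n -> 'I_n -> R) :
  \sum_(i < n) \sum_(j < n | (i < j)%N) G i j = \sum_(e : vertex_pair n) G (val e).1 (val e).2.
Proof.
rewrite (pair_big_dep predT (fun i j : 'I_n => (i < j)%N) G)/=.
rewrite (reindex_omap (val : vertex_pair n -> _) insub)/=.
  by apply: eq_bigl => e; rewrite valK eqxx andbT (valP e).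
by move=> [i j] /= ij; rewrite insubT.
Qed.

Lemma sum_edge_mx y (F : R -> R) :
  \sum_i \sum_j F (edge_mx y i j) = n%:R * F 0 + 2 * \sum_e F (y e).
Proof.
transitivity (\sum_(i < n) (F 0 + (\sum_(j < n | (i < j)%N) F (edge_mx y i j) +
                      \sum_(j < n | (j < i)%N) F (edge_mx y i j)))).
  apply: eq_bigr => i _; rewrite (bigD1 i)//= edge_mx_diag; congr (_ + _).
  rewrite (bigID (fun j : 'I_n => (i < j)%N))/=; congr (_ + _).
    by apply: eq_bigl => j; case: ltngtP => // ij; rewrite ?andbF// andbT;
      apply/eqP => ji; rewrite ji ltnn in ij.
  apply: eq_bigl => j; rewrite -leqNgt leq_eqVlt; case: (eqVneq j i) => [->|ji].
    by rewrite ltnn.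
  by rewrite -val_eqE in ji; rewrite (negbTE ji).
rewrite !big_split/= sumr_const card_ord mulr_natl; congr (_ + _).
have E1 : \sum_(i < n) \sum_(j < n | (i < j)%N) F (edge_mx y i j) = \sum_e F (y e).
  rewrite (sum_vertex_pair (fun i j => F (edge_mx y i j))).
  by apply: eq_bigr => e _; rewrite edge_mx_val.
rewrite E1 (exchange_big_dep predT)//=.
under [X in _ + X]eq_bigr do under eq_bigr do rewrite edge_mx_sym.
by rewrite E1; ring.
Qed.

Lemma adjacency_mx01 X i j : 0 <= edge_mx (fun e => (X e)%:R) i j <= 1.
Proof. by rewrite -edge_mx_adjacent ler0n lern1 leq_b1. Qed.

Lemma graphons_graphon_of X : (0 < n)%N -> graphons (@graphon_of R n X).
Proof.
move=> n0; rewrite graphon_ofE; apply: graphons_step_graphon => // i j.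
  by rewrite !edge_mx_adjacent edge_mx_sym.
by rewrite ler0n lern1 leq_b1.
Qed.

End EdgeMatrix.

(** * Exponential moments of the triangle density *)

Section CutBall.
Variable R : realType.
Implicit Types (p alpha beta eps : R).

(** With [s = a + b] both [a / s] and [b / s] lie in [0, 1], where raising to the
    power [alpha] increases.  It gives a modulus of continuity of [w ^ alpha] that
    is uniform down to 0. *)
Lemma powR_subadditive alpha (a b : R) : 0 < alpha <= 1 -> 0 <= a -> 0 <= b ->
  (a + b) `^ alpha <= a `^ alpha + b `^ alpha.
Proof.
move=> /andP[al0 al1] a0 b0; have [s0|sn0] := eqVneq (a + b) 0.
  by rewrite s0 powR0 ?gt_eqF// addr_ge0 ?powR_ge0.
have s_gt0 : 0 < a + b by rewrite lt_neqAle eq_sym sn0 addr_ge0.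
have key c : 0 <= c -> c <= a + b -> (a + b) `^ alpha * (c / (a + b)) <= c `^ alpha.
  move=> c0 cs; have [->|cn0] := eqVneq c 0.
    by rewrite mul0r mulr0 powR_ge0.
  have c_gt0 : 0 < c by rewrite lt_neqAle eq_sym cn0.
  rewrite -[c in leRHS](divfK sn0) [in leRHS]mulrC powRM ?divr_ge0 ?(ltW s_gt0)//.
  rewrite ler_pM2l ?powR_gt0//; apply: ger1_powR => //.
  by rewrite divr_gt0//= ler_pdivrMr// mul1r.
apply: (@le_trans _ _ ((a + b) `^ alpha * (a / (a + b)) +
                       (a + b) `^ alpha * (b / (a + b)))).
  by rewrite -mulrDr -mulrDl divff// mulr1.
by apply: lerD; apply: key => //; rewrite ?lerDl ?lerDr.
Qed.

Lemma graph_triangle_density n (X : graph n) : (0 < n)%N ->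
  triangle_density (@graphon_of R n X) =
  triangle_sum (edge_mx (fun e => (X e)%:R)) / n%:R ^+ 3.
Proof.
move=> n0; rewrite graphon_ofE triangle_density_step//; congr (_ / _).
apply: eq_bigr => i _; apply: eq_bigr => j _; apply: eq_bigr => k _.
by rewrite !edge_mx_adjacent.
Qed.

Lemma triangle_sum_le n (M N : 'I_n -> 'I_n -> R) eps : (0 < n)%N ->
  (forall i j, 0 <= M i j <= 1) -> (forall i j, 0 <= N i j <= 1) ->
  (forall S T, `|cut_sum (fun i j => M i j - N i j) S T| <= eps * n%:R ^+ 2) ->
  triangle_sum M / n%:R ^+ 3 <= triangle_sum N / n%:R ^+ 3 + 3 * eps.
Proof.
move=> n0 M01 N01 cut; have := triangle_sum_cut M01 N01 cut.
have n3 : 0 < n%:R ^+ 3 :> R by rewrite exprn_gt0// ltr0n.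
move=> /(le_trans (ler_norm _)) h.
rewrite -lerBlDl -mulrBl ler_pdivrMr//; apply: (le_trans h).
by rewrite natrM le_eqVlt; apply/orP; left; apply/eqP; ring.
Qed.

Section cut_ball.
Variables (n : nat) (p alpha beta L eta : R).
Hypotheses (n0 : (0 < n)%N) (p01 : 0 < p < 1) (al01 : 0 < alpha <= 1).
Hypotheses (beta0 : 0 <= beta) (eta0 : 0 < eta).
Hypothesis hL : forall f : R * R -> R, graphons f ->
  beta / 6 * triangle_density f `^ alpha - graphon_rate p f <= L.
Let P (X : graph n) : R := bernoulli_mass (fun=> p) X.
Let adj (X : graph n) := edge_mx (fun e => (X e)%:R : R).
Let g (w : R) := beta / 6 * w `^ alpha.

(** Let [Y] be the matrix of conditional edge probabilities given [A].  Being an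
    average of adjacency matrices of [A] it lies in the same cut ball, so that
    the triangle density of a graph of [A] exceeds that of [Y] by at most
    [6 * eta].  The probability of [A] is controlled by the rate of [Y], and the
    hypothesis on graphons bounds the sum of the two exponents.  The term
    [n * rate p 0] accounts for the zero diagonal of [Y]. *)
Lemma cut_ball_bound (A : {set graph n}) (D : 'I_n -> 'I_n -> R) :
  (forall X, X \in A -> forall S T,
    `|cut_sum (fun i j => adj X i j - D i j) S T| <= eta * n%:R ^+ 2) ->
  \sum_(X in A) P X *
    expR (n%:R ^+ 2 * g (triangle_density (@graphon_of R n X))) <=
  expR (n%:R ^+ 2 * (L + g (6 * eta)) + n%:R * rate p 0).
Proof.
move=> AD.
pose PA := \sum_(X in A) P X.
have P0 X : 0 < P X by exact: bernoulli_mass_gt0.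
have [A0|PAn0] := eqVneq PA 0.
  rewrite big1 ?expR_ge0// => X XA.
  have : P X <= PA by rewrite /PA (bigD1 X)//= lerDl sumr_ge0// => Y _; exact: ltW.
  by rewrite A0 leNgt P0.
have PA0 : 0 < PA.
  by rewrite lt_neqAle eq_sym PAn0 sumr_ge0// => Y _; exact: ltW.
pose y (e : vertex_pair n) := (\sum_(X in A) P X * (X e)%:R) / PA.
have [y01 PAle] : (forall e, 0 <= y e <= 1) /\
    PA <= expR (- (2 * \sum_e rate p (y e))) := entropy_bound p01 PA0.
have yE e : y e = \sum_(X in A) P X / PA * (X e)%:R.
  by rewrite /y mulr_suml; apply: eq_bigr => X _; rewrite mulrAC.
have nu1 : \sum_(X in A) P X / PA = 1 by rewrite -mulr_suml divff.
pose Y := edge_mx y.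
have YE i j : Y i j = \sum_(X in A) P X / PA * adj X i j.
  rewrite /Y /edge_mx; under eq_bigr do rewrite yE.
  by rewrite exchange_big/=; apply: eq_bigr => X _; rewrite mulr_sumr.
have Y01 i j : 0 <= Y i j <= 1.
  by apply: (edge_mx_ind (P := fun r => 0 <= r <= 1)); rewrite ?lexx ?ler01.
have adj01 X i j : 0 <= adj X i j <= 1 by exact: adjacency_mx01.
have cutsub (M1 M2 D' : 'I_n -> 'I_n -> R) (S T : {set 'I_n}) :
    cut_sum (fun i j => M1 i j - M2 i j) S T =
    cut_sum (fun i j => M1 i j - D' i j) S T - cut_sum (fun i j => M2 i j - D' i j) S T.
  rewrite /cut_sum -sumrB; apply: eq_bigr => i _.
  by rewrite -sumrB; apply: eq_bigr => j _; rewrite opprB addrA subrK.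
have YD S T : `|cut_sum (fun i j => Y i j - D i j) S T| <= eta * n%:R ^+ 2.
  have -> : cut_sum (fun i j => Y i j - D i j) S T =
      \sum_(X in A) P X / PA * cut_sum (fun i j => adj X i j - D i j) S T.
    rewrite /cut_sum; under [RHS]eq_bigr do rewrite mulr_sumr.
    rewrite [RHS]exchange_big/=; apply: eq_bigr => i _.
    under [RHS]eq_bigr do rewrite mulr_sumr.
    rewrite [RHS]exchange_big/=; apply: eq_bigr => j _.
    rewrite YE -[Z in _ - Z = _]mul1r -[Z in _ - Z * _ = _]nu1 mulr_suml -sumrB; apply: eq_bigr => X _.
    by rewrite mulrBr.
  apply: (le_trans (ler_norm_sum _ _ _)).
  rewrite -[leRHS]mul1r -[Z in _ <= Z * _]nu1 mulr_suml; apply: ler_sum => X XA.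
  by rewrite normrM gtr0_norm ?divr_gt0// ler_pM2l ?divr_gt0//; exact: AD.
have cutXY X S T : X \in A ->
    `|cut_sum (fun i j => adj X i j - Y i j) S T| <= (2 * eta) * n%:R ^+ 2.
  move=> XA; rewrite (cutsub _ _ D); apply: (le_trans (ler_normB _ _)).
  by have := AD _ XA S T; have := YD S T; lra.
pose f := step_graphon Y.
have gf : graphons f.
  by apply: graphons_step_graphon => // i j; exact: edge_mx_sym.
have /andP[TY0 _] := triangle_density01 gf.
have TX X : X \in A ->
    triangle_density (@graphon_of R n X) <= triangle_density f + 6 * eta.
  move=> XA; rewrite graph_triangle_density// triangle_density_step//.
  apply: (le_trans (triangle_sum_le n0 (adj01 X) Y01 (fun S T => cutXY X S T XA))).
  by rewrite lerD2l mulrA -natrM.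
have sum0 : 0 <= triangle_density f + 6 * eta.
  by apply: (addr_ge0 TY0); rewrite mulr_ge0// ltW.
have b6 : 0 <= beta / 6 by rewrite divr_ge0.
have gX X : X \in A ->
    g (triangle_density (@graphon_of R n X)) <= g (triangle_density f) + g (6 * eta).
  move=> XA; rewrite /g -mulrDr ler_wpM2l//.
  apply: le_trans (powR_subadditive al01 TY0 _); last by rewrite mulr_ge0// ltW.
  have /andP[TX0 _] := triangle_density01 (graphons_graphon_of R X n0).
  by apply: (ge0_ler_powR _ TX0 sum0 (TX _ XA)); case/andP: al01 => /ltW.
have n2 : 0 < n%:R ^+ 2 :> R by rewrite exprn_gt0// ltr0n.
apply: (@le_trans _ _ (PA * expR (n%:R ^+ 2 * (g (triangle_density f) + g (6 * eta))))).
  rewrite mulr_suml; apply: ler_sum => X XA.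
  by rewrite ler_pM2l// ler_expR ler_pM2l//; exact: gX.
apply: (le_trans (ler_wpM2r (expR_ge0 _) PAle)).
rewrite -expRD ler_expR.
have := hL gf; rewrite -/(g _) => hLf.
have rE : n%:R ^+ 2 * graphon_rate p f = n%:R * rate p 0 + 2 * \sum_e rate p (y e).
  by rewrite graphon_rate_step// mulrC divfK ?gt_eqF// sum_edge_mx.
have := ler_wpM2l (ltW n2) hLf; rewrite mulrBr rE mulrDr => h.
rewrite mulrDr; lra.
Qed.

End cut_ball.
End CutBall.

Section TiltedMean.
Variable R : realType.
Implicit Types (p alpha beta eps : R).

Lemma near_linear_le (c eps : R) : 0 < eps ->
  \forall n \near \oo, c * n%:R <= eps * n%:R ^+ 2.
Proof.
move=> eps0; exists (Num.truncn (c / eps)).+1 => // n /= nc.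
rewrite expr2 mulrA ler_wpM2r// -ler_pdivrMl// mulrC.
apply/ltW; apply: (lt_le_trans (truncnS_gt _)).
by rewrite ler_nat.
Qed.

(** Sorting the graphs by their decomposition into rectangles splits the
    expectation into [exp (O(n))] sums, each bounded by [cut_ball_bound]. *)
Lemma tilted_mean_upper p alpha beta L eps : 0 < p < 1 -> 0 < alpha <= 1 ->
  0 <= beta ->
  (forall f : R * R -> R, graphons f ->
    beta / 6 * triangle_density f `^ alpha - graphon_rate p f <= L) ->
  0 < eps ->
  \forall n \near \oo,
    \sum_(X : graph n) bernoulli_mass (fun=> p) X *
      expR (n%:R ^+ 2 * (beta / 6 * triangle_density (@graphon_of R n X) `^ alpha))
    <= expR (n%:R ^+ 2 * (L + eps)).
Proof.
move=> p01 al01 beta0 hL eps0.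
have /andP[al0 al1] := al01.
have b6 : 0 <= beta / 6 by rewrite divr_ge0.
pose kappa := eps / (4 * (beta / 6 + 1)).
have kappa0 : 0 < kappa by rewrite divr_gt0// mulr_gt0//; lra.
(* Chosen so that (6 * eta) ^ alpha is kappa. *)
pose eta := kappa `^ alpha^-1 / 6.
have eta0 : 0 < eta by rewrite divr_gt0// powR_gt0.
have geta : beta / 6 * (6 * eta) `^ alpha <= eps / 4.
  rewrite /eta [6 * _]mulrC divfK ?pnatr_eq0// -powRrM mulVf ?gt_eqF//.
  rewrite (powRr1 (ltW kappa0)) /kappa mulrA ler_pdivrMr ?mulr_gt0//; last by lra.
  by nra.
pose K := (Num.truncn (eta ^+ 2)^-1).+1.
have Keta : 1 < K%:R * eta ^+ 2.
  by rewrite -ltr_pdivrMr ?exprn_gt0// mul1r; exact: truncnS_gt.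
have := @near_linear_le (4 * K%:R + rate p 0) (eps / 2).
move=> /(_ ltac:(lra)) near_n.
near=> n.
have n0 : (0 < n)%N by near: n; exists 1%N.
pose adj (X : graph n) := edge_mx (fun e => (X e)%:R : R).
have adj01 X i j : 0 <= adj X i j <= 1 by exact: adjacency_mx01.
pose code (X : graph n) : K.-tuple (block n) :=
  sval (cid (block_approx eta0 Keta n0 (adj01 X))).
have codeP X S T : `|cut_sum (fun i j => adj X i j - blocks_mx eta (code X) i j) S T|
    <= eta * n%:R ^+ 2.
  exact: (svalP (cid (block_approx eta0 Keta n0 (adj01 X)))).
rewrite (partition_big code predT)//=.
set B := expR (n%:R ^+ 2 * (L + beta / 6 * (6 * eta) `^ alpha) + n%:R * rate p 0).
apply: (@le_trans _ _ (\sum_(l : K.-tuple (block n)) B)).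
  apply: ler_sum => l _.
  rewrite (eq_bigl (fun X => X \in [set X | code X == l]%SET)); last first.
    by move=> X; rewrite inE.
  apply: (@cut_ball_bound R n p alpha beta L eta n0 p01 al01 beta0 eta0 hL
    [set X | code X == l]%SET (blocks_mx eta l)).
  by move=> X; rewrite inE => /eqP <- S T; exact: codeP.
rewrite sumr_const -[leLHS]mulr_natl.
apply: (@le_trans _ _ (expR (((2 * n + 2) * K)%:R) * B)).
  apply: ler_wpM2r; first exact: expR_ge0.
  apply: (@le_trans _ _ (2 ^ ((2 * n + 2) * K))%N%:R).
    by rewrite ler_nat; exact: card_block_tuple.
  rewrite natrX -[X in expR X]mulr1 expRM_natl lerXn2r ?nnegrE ?expR_ge0//.
  by have := expR_ge1Dx (1 : R); lra.
rewrite /B -expRD ler_expR.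
have n2 : 0 < n%:R ^+ 2 :> R by rewrite exprn_gt0// ltr0n.
have hn : (4 * K%:R + rate p 0) * n%:R <= eps / 2 * n%:R ^+ 2 by near: n.
have : ((2 * n + 2) * K)%:R <= 4 * K%:R * n%:R :> R.
  rewrite -!natrM ler_nat -mulnA (mulnC K) mulnA leq_mul2r; apply/orP; right.
  by clear -n0; lia.
have := ler_wpM2l (ltW n2) geta.
have : 0 < eps * n%:R ^+ 2 by rewrite mulr_gt0.
rewrite !mulrDr; lra.
Unshelve. all: by end_near. Qed.

End TiltedMean.

(** * Approximation of measurable functions by step functions *)

Section Density.
Variable R : realType.
Lemma near_inv_le (eps : R) : 0 < eps -> \forall n \near \oo, n%:R^-1 <= eps.
Proof.
move=> eps0; exists (Num.truncn eps^-1).+1 => // n /= nc.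
have n0 : 0 < n%:R :> R by rewrite ltr0n; exact: leq_trans nc.
rewrite -[leRHS]invrK lef_pV2 ?posrE ?invr_gt0//.
by apply/ltW; apply: (lt_le_trans (truncnS_gt _)); rewrite ler_nat.
Qed.

Local Notation cell := (@cell R _).
Implicit Types (f g h : R * R -> R).

Lemma int01_le_co (h k : R -> R) :
  bounded_measurable h -> bounded_measurable k ->
  (forall x, 0 <= x < 1 -> h x <= k x) -> int01 h <= int01 k.
Proof.
move=> bh bk hk.
pose J (x : R) : R := \1_(`[0%R, 1%R[%classic : set R) x.
have bJ : bounded_measurable J.
  by apply: bounded_measurable_indic; exact: measurable_itv.
have bhJ := bounded_measurableM bh bJ.
have bkJ := bounded_measurableM bk bJ.
have JE x : 0 <= x < 1 -> J x = 1.
  by move=> x01; rewrite /J indicE mem_set//= in_itv.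
rewrite (int01_ext_co bh bhJ); last by move=> x x01; rewrite JE// mulr1.
rewrite (int01_ext_co bk bkJ); last by move=> x x01; rewrite JE// mulr1.
apply: (int01_le bhJ bkJ) => x x01.
have [x1|x1] := boolP (0 <= x < 1); first by rewrite JE// !mulr1 hk.
by rewrite /J indicE memNset ?mulr0//= in_itv/=; exact/negP.
Qed.

Lemma int2_le_co h k : bounded_measurable h -> bounded_measurable k ->
  (forall x y, 0 <= x < 1 -> 0 <= y < 1 -> h (x, y) <= k (x, y)) ->
  int2 h <= int2 k.
Proof.
move=> bh bk hk; apply: (int01_le_co (bounded_measurable_int01 bh)
  (bounded_measurable_int01 bk)) => x x01.
apply: (int01_le_co (bounded_measurable_slice x bh) (bounded_measurable_slice x bk)).
by move=> y y01; exact: hk.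
Qed.

Lemma int2_cvg (h_ : nat -> R * R -> R) h (C : R) :
  (forall n, measurable_fun setT (h_ n)) -> (forall n z, `|h_ n z| <= C) ->
  (forall z, h_ ^~ z @ \oo --> h z) ->
  int2 (h_ n) @[n --> \oo] --> int2 h.
Proof.
move=> mh hC hh.
have bh n : bounded_measurable (h_ n) by split => //; exists C.
apply: (@int01_cvg R (fun n x => int01 (fun y => h_ n (x, y))) _ C).
- by move=> n; case: (bounded_measurable_int01 (bh n)).
- move=> n x; apply: (le_trans (int01_norm (bounded_measurable_slice x (bh n)))).
  rewrite -[leRHS](int01_cst C); apply: int01_le => [||y _]; last exact: hC.
    exact: bounded_measurable_norm (bounded_measurable_slice x (bh n)).
  exact: bounded_measurable_cst.
- move=> x; apply: (@int01_cvg R (fun n y => h_ n (x, y)) _ C) => [n|n y|y].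
  + by case: (bounded_measurable_slice x (bh n)).
  + exact: hC.
  + exact: hh.
Qed.

Definition L1dist f g : R := int2 (fun z => `|f z - g z|).

Lemma L1dist_measurable f g : bounded_measurable f -> bounded_measurable g ->
  bounded_measurable (fun z => `|f z - g z|).
Proof. by move=> bf bg; exact: bounded_measurable_norm (bounded_measurableB bf bg). Qed.

(** The comparison is only needed on [0, 1)^2, where every point lies in a
    cell. *)
Lemma L1dist_le_co f g f1 g1 f2 g2 a b :
  bounded_measurable f -> bounded_measurable g ->
  bounded_measurable f1 -> bounded_measurable g1 ->
  bounded_measurable f2 -> bounded_measurable g2 ->
  (forall x y, 0 <= x < 1 -> 0 <= y < 1 ->
    `|f (x, y) - g (x, y)| <= a * `|f1 (x, y) - g1 (x, y)| +
                              b * `|f2 (x, y) - g2 (x, y)|) ->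
  L1dist f g <= a * L1dist f1 g1 + b * L1dist f2 g2.
Proof.
move=> bf bg bf1 bg1 bf2 bg2 le.
have b1 := L1dist_measurable bf1 bg1; have b2 := L1dist_measurable bf2 bg2.
have b1' := bounded_measurableM (bounded_measurable_cst _ a) b1.
have b2' := bounded_measurableM (bounded_measurable_cst _ b) b2.
rewrite /L1dist -(int2Z a b1) -(int2Z b b2) -(int2D b1' b2').
exact: (int2_le_co (L1dist_measurable bf bg) (bounded_measurableD b1' b2') le).
Qed.

Lemma L1dist_triangle_co f g f1 g1 f2 g2 d1 d2 :
  bounded_measurable f -> bounded_measurable g ->
  bounded_measurable f1 -> bounded_measurable g1 ->
  bounded_measurable f2 -> bounded_measurable g2 ->
  (forall x y, 0 <= x < 1 -> 0 <= y < 1 ->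
    `|f (x, y) - g (x, y)| <= `|f1 (x, y) - g1 (x, y)| +
                              `|f2 (x, y) - g2 (x, y)|) ->
  L1dist f1 g1 <= d1 -> L1dist f2 g2 <= d2 -> L1dist f g <= d1 + d2.
Proof.
move=> bf bg bf1 bg1 bf2 bg2 le h1 h2.
have := @L1dist_le_co f g f1 g1 f2 g2 1 1 bf bg bf1 bg1 bf2 bg2.
move: (L1dist f g) (L1dist f1 g1) (L1dist f2 g2) h1 h2 => D D1 D2 h1 h2.
rewrite !mul1r => H; apply: (le_trans (H _) (lerD h1 h2)) => x y x01 y01.
by rewrite !mul1r; exact: le.
Qed.

(** The same mesh serves for all functions, so that approximants can be added and
    multiplied cell by cell; and an approximant exists for every large [n], as
    needed for a limit along all numbers of vertices. *)
Definition approximable f := forall delta, 0 < delta ->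
  \forall n \near \oo, exists c : 'I_n -> 'I_n -> R,
    L1dist f (step_graphon c) <= delta.

Let bstep n (c : 'I_n -> 'I_n -> R) : (0 < n)%N -> bounded_measurable (step_graphon c).
Proof. by move=> n0; exact: bounded_measurable_step_graphon. Qed.

Lemma approximable_lincomb a b f g : bounded_measurable f -> bounded_measurable g ->
  approximable f -> approximable g -> approximable (fun z => a * f z + b * g z).
Proof.
move=> bf bg af ag d d0.
pose M := `|a| + `|b| + 1.
have M0 : 0 < M by rewrite /M ltr_wpDl// addr_ge0.
have dM : 0 < d / M by rewrite divr_gt0.
apply: filterS3 (nbhs_infty_gt 0) (af _ dM) (ag _ dM) => n n0 [c hc] [e he].
exists (fun i j => a * c i j + b * e i j).
have bl := bounded_measurableD (bounded_measurableM (bounded_measurable_cst _ a) bf)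
  (bounded_measurableM (bounded_measurable_cst _ b) bg).
have := @L1dist_le_co _ _ f (step_graphon c) g (step_graphon e) `|a| `|b| bl
  (bstep (fun i j => a * c i j + b * e i j) n0) bf (bstep c n0) bg (bstep e n0).
move=> le; apply: (le_trans (le _)) => {le}.
  move=> x y x01 y01; have [i ix] := cell_cover n0 x01; have [j jy] := cell_cover n0 y01.
  rewrite !(step_graphonE _ ix jy) -!normrM.
  rewrite (_ : _ - _ = a * (f (x, y) - c i j) + b * (g (x, y) - e i j)); last by ring.
  exact: ler_normD.
have h1 := ler_wpM2l (normr_ge0 a) hc; have h2 := ler_wpM2l (normr_ge0 b) he.
apply: (le_trans (lerD h1 h2)); rewrite -mulrDl mulrA ler_pdivrMr// mulrC.
by rewrite ler_pM2l// /M lerDl.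
Qed.

(** Truncating the coefficients to an interval that contains the values of [f] does
    not increase the distance. *)
Lemma approximable_clip lo hi f : lo <= hi -> bounded_measurable f ->
  (forall x y, 0 <= x < 1 -> 0 <= y < 1 -> lo <= f (x, y) <= hi) ->
  approximable f -> forall delta, 0 < delta ->
  \forall n \near \oo, exists2 c : 'I_n -> 'I_n -> R,
    (forall i j, lo <= c i j <= hi) & L1dist f (step_graphon c) <= delta.
Proof.
move=> lohi bf flh af d d0; apply: filterS2 (nbhs_infty_gt 0) (af _ d0) => n n0 [c hc].
pose clip u := Num.max lo (Num.min hi u).
have clipP u : lo <= clip u <= hi.
  by rewrite /clip le_max lexx/= ge_max lohi ge_min lexx.
exists (fun i j => clip (c i j)); first by move=> i j; exact: clipP.
apply: (le_trans _ hc).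
have := @L1dist_le_co _ _ f (step_graphon c) f f 1 0 bf
  (bstep (fun i j => clip (c i j)) n0) bf (bstep c n0) bf bf.
rewrite mul0r mul1r addr0; apply => x y x01 y01.
have [i ix] := cell_cover n0 x01; have [j jy] := cell_cover n0 y01.
rewrite !(step_graphonE _ ix jy) mul0r addr0 mul1r.
have /andP[fl fh] := flh _ _ x01 y01.
rewrite /clip; case: (leP hi (c i j)) => ch.
  by rewrite max_r// !ler0_norm ?subr_le0// ?(le_trans fh)//; lra.
case: (leP lo (c i j)) => cl => //.
by rewrite !ger0_norm ?subr_ge0//; lra.
Qed.

Lemma approximableM f g : bounded_measurable f -> bounded_measurable g ->
  (forall z, 0 <= f z <= 1) -> (forall z, 0 <= g z <= 1) ->
  approximable f -> approximable g -> approximable (fun z => f z * g z).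
Proof.
move=> bf bg f01 g01 af ag d d0.
have d2 : 0 < d / 2 by rewrite divr_gt0.
have f01' x y (_ : 0 <= x < 1) (_ : 0 <= y < 1) := f01 (x, y).
apply: filterS3 (nbhs_infty_gt 0) (approximable_clip ler01 bf f01' af d2)
  (ag _ d2) => n n0 [c c01 hc] [e he].
exists (fun i j => c i j * e i j).
rewrite [leRHS]splitr; apply: (L1dist_triangle_co (bounded_measurableM bf bg)
  (bstep _ n0) bf (bstep c n0) bg (bstep e n0) _ hc he) => x y x01 y01.
have [i ix] := cell_cover n0 x01; have [j jy] := cell_cover n0 y01.
rewrite !(step_graphonE _ ix jy).
rewrite (_ : _ - _ = g (x, y) * (f (x, y) - c i j) + c i j * (g (x, y) - e i j)); last by ring.
apply: (le_trans (ler_normD _ _)); apply: lerD; rewrite normrM.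
  by have /andP[? ?] := g01 (x, y); rewrite ler_piMl// ger0_norm.
by have /andP[? ?] := c01 i j; rewrite ler_piMl// ger0_norm.
Qed.

Lemma approximable_closed f : bounded_measurable f ->
  (forall delta, 0 < delta -> exists g, [/\ bounded_measurable g, approximable g &
    L1dist f g <= delta]) -> approximable f.
Proof.
move=> bf lim d d0; have d2 : 0 < d / 2 by rewrite divr_gt0.
have [g [bg ag fg]] := lim _ d2.
apply: filterS2 (nbhs_infty_gt 0) (ag _ d2) => n n0 [c hc].
exists c; rewrite [leRHS]splitr.
apply: (L1dist_triangle_co bf (bstep c n0) bf bg bg (bstep c n0) _ fg hc).
by move=> x y _ _; exact: ler_distD.
Qed.

Lemma approximable_cst a : approximable (fun=> a).
Proof.
move=> d d0; apply: filterS (nbhs_infty_gt 0) => n n0.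
exists (fun _ _ => a); apply: le_trans (ltW d0).
have := int2_le_co (L1dist_measurable (bounded_measurable_cst _ a)
  (bstep (fun (_ _ : 'I_n) => a) n0)) (bounded_measurable_cst _ 0).
rewrite int2_cst; apply => x y x01 y01.
have [i ix] := cell_cover n0 x01; have [j jy] := cell_cover n0 y01.
by rewrite !(step_graphonE _ ix jy) subrr normr0.
Qed.

Lemma approximable_swap f : bounded_measurable f -> approximable f ->
  approximable (fun z => f (z.2, z.1)).
Proof.
move=> bf af d d0; apply: filterS2 (nbhs_infty_gt 0) (af _ d0) => n n0 [c hc].
exists (fun i j => c j i); apply: (le_trans _ hc).
have bd := L1dist_measurable bf (bstep c n0).
rewrite /L1dist [leRHS]/int2 (int01_swap bd).
have bs := bounded_measurable_swap bf; have bd' := bounded_measurable_swap bd.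
apply: (int2_le_co (L1dist_measurable bs (bstep (fun i j => c j i) n0)) bd').
move=> x y x01 y01 /=.
have [i ix] := cell_cover n0 x01; have [j jy] := cell_cover n0 y01.
by rewrite (step_graphonE _ ix jy) (step_graphonE _ jy ix).
Qed.

(** The function and its values at the left ends of the cells differ only above
    the cell that contains [a], of width [1 / n]. *)
Lemma approximable_ray (a : R) :
  approximable (fun z => \1_(`[a, +oo[%classic : set R) z.1).
Proof.
move=> d d0.
have bray : bounded_measurable (fun z : R * R => \1_(`[a, +oo[%classic : set R) z.1 : R).
  apply: (@bounded_measurable_comp _ _ _ _ _ fst); first exact: measurable_fst.
  by apply: bounded_measurable_indic; exact: measurable_itv.
pose r (x : R) : R := \1_(`[a, +oo[%classic : set R) x.
have rE x : r x = (a <= x)%R%:R by rewrite /r indicE mem_setE in_itv/= andbT.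
apply: filterS2 (nbhs_infty_gt 0) (near_inv_le d0) => n n0 nd.
have n0' : 0 < n%:R :> R by rewrite ltr0n.
exists (fun i _ => r (i%:R / n%:R)); apply: (le_trans _ nd).
(* Only the strip of cells whose base contains a contributes. *)
pose b (x : R) : R := \sum_(i < n) (a \in cell i)%:R * \1_(cell i) x.
have bI i : bounded_measurable (fun x : R => (a \in cell i)%:R * \1_(@Defs.cell R n i) x : R).
  apply: bounded_measurableM; first exact: bounded_measurable_cst.
  by apply: bounded_measurable_indic; exact: measurable_cell.
have bb : bounded_measurable b by exact: bounded_measurable_sum.
have -> : n%:R^-1 = n%:R^-1 * 1 :> R by rewrite mulr1.
have le_b : int01 b <= n%:R^-1.
  rewrite int01_sum//.
  under eq_bigr => i _.
    rewrite int01Z ?int01_cell; last first.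
      by apply: bounded_measurable_indic; exact: measurable_cell.
    over.
  rewrite -mulr_suml -[leRHS]mul1r ler_pM2r ?invr_gt0//.
  have [[i ai]|noi] := pselect (exists i : 'I_n, cell i a).
    rewrite (bigD1 i)//= big1 ?addr0 ?mem_set// => k ki.
    by rewrite memNset// => ka; move/eqP: ki; apply; exact: cell_inj ka ai.
  by rewrite big1// => i _; rewrite memNset// => ai; apply: noi; exists i.
rewrite mulr1; apply: le_trans le_b.
have bbf : bounded_measurable (fun z : R * R => b z.1).
  by apply: (@bounded_measurable_comp _ _ _ _ _ fst) bb; exact: measurable_fst.
have -> : int01 b = int2 (fun z => b z.1).
  by apply: int01_ext => x _ /=; rewrite int01_cst.
apply: (int2_le_co (L1dist_measurable bray (bstep (fun i _ => r (i%:R / n%:R)) n0)) bbf).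
move=> x y x01 y01 /=.
have [i ix] := cell_cover n0 x01; have [j jy] := cell_cover n0 y01.
rewrite (step_graphonE _ ix jy) -/(r x) !rE.
have -> : b x = (a \in cell i)%:R.
  rewrite /b (bigD1 i)//= big1 ?addr0 ?[in LHS]indicE ?(mem_set ix) ?mulr1// => k ki.
  rewrite indicE (@memNset _ (cell k) x) ?mulr0// => kx.
  by move/eqP: ki; apply; exact: cell_inj kx ix.
move: (ix); rewrite /Defs.cell/= in_itv/= => /andP[ix1 ix2].
case: (leP a x) => ax; case: (leP a (i%:R / n%:R)) => ai /=;
  rewrite ?subrr ?normr0 ?subr0 ?normr1//.
  by rewrite mem_set//= in_itv/= (ltW ai) (le_lt_trans ax).
by have := lt_le_trans ax (le_trans ai ix1); rewrite ltxx.
Qed.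

End Density.

Section MeasurableDensity.
Variable R : realType.
Implicit Types (f g h : R * R -> R).

Lemma approximable_sum (F : nat -> R * R -> R) n :
  (forall k, bounded_measurable (F k)) -> (forall k, approximable (F k)) ->
  approximable (fun z => \sum_(k < n) F k z).
Proof.
move=> bF aF; elim: n => [|n ih].
  rewrite (_ : (fun _ => _) = fun=> 0); first exact: approximable_cst.
  by apply/funext => z; rewrite big_ord0.
rewrite (_ : (fun _ => _) = fun z => 1 * \sum_(k < n) F k z + 1 * F n z).
  have bs := bounded_measurable_sum (index_enum 'I_n) (fun k : 'I_n => bF k).
  exact: (approximable_lincomb 1 1 bs (bF n) ih (aF n)).
by apply/funext => z; rewrite big_ord_recr/= !mul1r.
Qed.

(** The finite partial sums are approximable and converge in L^1 by bounded
    convergence. *)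
Lemma approximable_bigcup d (T : measurableType d) (pi : R * R -> T)
    (F : (set T)^nat) : measurable_fun setT pi ->
  (forall n, measurable (F n)) -> trivIset setT F ->
  (forall n, approximable (fun z => \1_(F n) (pi z))) ->
  approximable (fun z => \1_(\bigcup_k F k) (pi z)).
Proof.
move=> mpi mF tF aF.
have b1 (A : set T) : measurable A -> bounded_measurable (fun z => \1_A (pi z) : R).
  by move=> mA; apply: (bounded_measurable_comp mpi); exact: bounded_measurable_indic.
have bU := b1 _ (bigcupT_measurable F mF).
pose S n z : R := \sum_(k < n) \1_(F k) (pi z).
have bS n : bounded_measurable (S n).
  exact: (bounded_measurable_sum _ (fun k : 'I_n => b1 _ (mF k))).
have SE n z k : F k (pi z) -> S n z = (k < n)%N%:R.
  move=> kz; have E (j : 'I_n) : \1_(F j) (pi z) = (j == k :> nat)%:R :> R.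
    rewrite indicE; case: eqVneq => [->|jk]; first by rewrite mem_set.
    rewrite memNset// => jz; move/eqP: jk; apply; apply: tF => //.
    by exists (pi z).
  rewrite /S (eq_bigr _ (fun j _ => E j)).
  case: (ltnP k n) => kn; last first.
    by rewrite big1// => j _; case: eqP => // jk; have := ltn_ord j; rewrite jk ltnNge kn.
  rewrite (bigD1 (Ordinal kn))//= eqxx big1 ?addr0// => j jk.
  by rewrite -val_eqE/= in jk; rewrite (negbTE jk).
have S0 n z : ~ (\bigcup_k F k) (pi z) -> S n z = 0.
  move=> nz; rewrite /S big1// => j _; rewrite indicE memNset// => jz.
  by apply: nz; exists j.
have cv : int2 (fun z => `|\1_(\bigcup_k F k) (pi z) - S n z|) @[n --> \oo] --> int2 (fun=> 0 : R).
  apply: (@int2_cvg R _ _ 1) => [n|n z|z].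
  - by case: (L1dist_measurable bU (bS n)).
  - rewrite normr_id; have [[k _ kz]|nz] := pselect ((\bigcup_k F k) (pi z)).
      rewrite (SE _ _ _ kz) indicE mem_set; last by exists k.
      by case: (k < n)%N; rewrite ?subrr ?subr0 ?normr0 ?normr1.
    by rewrite S0// indicE memNset// subrr normr0.
  - apply: cvg_near_cst.
    have [[k _ kz]|nz] := pselect ((\bigcup_k F k) (pi z)).
      near=> n; rewrite (SE _ _ _ kz) indicE mem_set; last by exists k.
      by rewrite (_ : (k < n)%N) ?subrr ?normr0//; near: n; exact: nbhs_infty_gt.
    by apply: nearW => n; rewrite S0// indicE memNset// subrr normr0.
apply: (approximable_closed bU) => delta d0.
move/cvgrPdist_le : cv => /(_ _ d0) [N _ /(_ N (leqnn N))]; rewrite int2_cst sub0r normrN.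
move=> hN; exists (S N); split => //.
  exact: (@approximable_sum (fun k z => \1_(F k) (pi z)) N (fun k => b1 _ (mF k)) aF).
exact: le_trans (ler_norm _) hN.
Unshelve. all: by end_near. Qed.

(** The sets with approximable indicator form a lambda-system.  The map [pi] lets
    the same argument serve for each coordinate and for the plane. *)
Lemma approximable_dynkin d (T : measurableType d) (pi : R * R -> T) (G : set (set T)) :
  measurable_fun setT pi -> @measurable _ T = <<s G >> -> setI_closed G ->
  (forall A, G A -> approximable (fun z => \1_A (pi z))) ->
  forall A, measurable A -> approximable (fun z => \1_A (pi z)).
Proof.
move=> mpi GE GI aG A mA.
apply: (@dynkin_induction _ T G (fun A => approximable (fun z => \1_A (pi z))) GE GI).
- rewrite (_ : (fun _ => _) = fun=> 1); first exact: approximable_cst.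
  by apply/funext => z; rewrite indicT.
- exact: aG.
- move=> S mS aS.
  rewrite (_ : (fun _ => _) = fun z => 1 * (fun=> 1) z + (-1) * \1_S (pi z)).
    have bS : bounded_measurable (fun z => \1_S (pi z) : R).
      by apply: (bounded_measurable_comp mpi); exact: bounded_measurable_indic.
    exact: (approximable_lincomb 1 (-1) (bounded_measurable_cst _ _) bS
      (approximable_cst 1) aS).
  apply/funext => z; rewrite mulN1r mul1r !indicE in_setC.
  by case: (_ \in _); rewrite ?subrr ?subr0.
- by move=> F mF tF aF; exact: approximable_bigcup.
- by rewrite -GE.
Qed.

Lemma approximable_fst (A : set R) : measurable A ->
  approximable (fun z => \1_A z.1).
Proof.
move=> mA; apply: (@approximable_dynkin _ _ fst (@RGenCInfty.G R)) => //.
- exact: RGenCInfty.measurableE.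
- move=> _ _ [a ->] [b ->]; exists (Num.max a b).
  by apply/seteqP; split => x; rewrite /= !in_itv/= !andbT ge_max => /andP.
- by move=> _ [a ->]; exact: approximable_ray.
Qed.

Lemma bounded_measurable_fst (A : set R) : measurable A ->
  bounded_measurable (fun z : R * R => \1_A z.1 : R).
Proof.
move=> mA; apply: (@bounded_measurable_comp _ _ _ _ _ fst).
  exact: measurable_fst.
exact: bounded_measurable_indic.
Qed.

Lemma approximable_snd (A : set R) : measurable A ->
  approximable (fun z => \1_A z.2).
Proof.
move=> mA.
exact: (approximable_swap (bounded_measurable_fst mA) (approximable_fst mA)).
Qed.

(** Rectangles with measurable sides are products of functions of one
    coordinate, and they generate the sigma-algebra of the plane. *)
Lemma approximable_indic (A : set (R * R)) : measurable A ->
  approximable (fun z => \1_A z).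
Proof.
move=> mA; apply: (@approximable_dynkin _ _ id
  [set B `*` C | B in measurable & C in measurable]) => //.
- exact: measurable_prod_measurableType.
- move=> _ _ [B mB [C mC <-]] [B' mB' [C' mC' <-]].
  exists (B `&` B'); first exact: measurableI.
  exists (C `&` C'); first exact: measurableI.
  by rewrite setXI.
- move=> _ [B mB [C mC <-]].
  rewrite (_ : (fun _ => _) = fun z => \1_B z.1 * \1_C z.2); last first.
    by apply/funext => z; rewrite !indicE in_setX; do 2 case: (_ \in _);
      rewrite ?(mulr1, mulr0).
  have i01 (D : set R) x : 0 <= (\1_D x : R) <= 1.
    by rewrite indicE; case: (_ \in _); rewrite ?lexx ?ler01.
  apply: approximableM.
  + exact: bounded_measurable_fst.
  + exact: (bounded_measurable_swap (bounded_measurable_fst mC)).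
  + by move=> z; exact: i01.
  + by move=> z; exact: i01.
  + exact: approximable_fst.
  + exact: approximable_snd.
Qed.

Lemma sum_nat_le (x : R) m : 0 <= x <= m%:R ->
  \sum_(k < m) (k.+1%:R <= x)%R%:R = (Num.truncn x)%:R :> R.
Proof.
move=> /andP[x0 xm].
have tm : (Num.truncn x <= m)%N.
  by rewrite -(ler_nat R); apply: le_trans xm; rewrite truncn_le.
transitivity (\sum_(k < m) ((k < Num.truncn x)%N : nat)%:R : R).
  by apply: eq_bigr => k _; rewrite -truncn_ge_nat.
rewrite -natr_sum; congr (_%:R).
transitivity (\sum_(k < m | (k < Num.truncn x)%N) 1)%N.
  by rewrite [RHS]big_mkcond; apply: eq_bigr => k _; case: ltnP.
by rewrite -(big_ord_widen m (fun=> 1%N) tm) sum1_card card_ord.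
Qed.

(** The integer part of [m * f], divided by [m], is an average of indicators of
    level sets and is within [1 / m] of [f]. *)
Theorem approximable_measurable f : measurable_fun setT f ->
  (forall z, 0 <= f z <= 1) -> approximable f.
Proof.
move=> mf f01.
have bf := bounded_measurable01 mf f01.
apply: (approximable_closed bf) => delta d0.
have [N _ /(_ N.+1 (leqnSn N))] := near_inv_le d0; set m := N.+1 => mdelta.
have m0 : 0 < m%:R :> R by [].
pose A k := [set z | k.+1%:R <= m%:R * f z].
have mA k : measurable (A k).
  rewrite (_ : A k = f @^-1` `[k.+1%:R / m%:R, +oo[%classic).
    by rewrite -[_ @^-1` _]setTI; apply: mf => //; exact: measurable_itv.
  by apply/seteqP; split => z; rewrite /A/= in_itv/= andbT ler_pdivrMr// mulrC.
have bA k : bounded_measurable (fun z => \1_(A k) z : R).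
  exact: bounded_measurable_indic.
have bS := bounded_measurable_sum (index_enum 'I_m) (fun k : 'I_m => bA k).
have aS := @approximable_sum _ m bA (fun k => approximable_indic (mA k)).
pose g z : R := m%:R^-1 * \sum_(k < m) \1_(A k) z + 0 * \sum_(k < m) \1_(A k) z.
have bg : bounded_measurable g.
  exact: bounded_measurableD (bounded_measurableM (bounded_measurable_cst _ _) bS)
    (bounded_measurableM (bounded_measurable_cst _ _) bS).
exists g; split; [exact: bg|exact: (approximable_lincomb _ _ bS bS aS aS)|].
apply: le_trans mdelta; rewrite -[leRHS]int2_cst.
apply: (int2_le_co (L1dist_measurable bf bg) (bounded_measurable_cst _ _)).
move=> x y _ _; rewrite /g mul0r addr0.
have /andP[f0 f1] := f01 (x, y).
have mf0 : 0 <= m%:R * f (x, y) by rewrite mulr_ge0.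
have mf1 : m%:R * f (x, y) <= m%:R by rewrite ler_piMr.
rewrite (eq_bigr (fun k : 'I_m => (k.+1%:R <= m%:R * f (x, y))%R%:R)); last first.
  by move=> k _; rewrite indicE mem_setE.
rewrite sum_nat_le ?mf0//.
have /andP[t1 t2] := truncn_itv mf0.
rewrite -(ler_pM2l m0) -{1}(ger0_norm (ltW m0)) -normrM mulrBr mulVKf ?gt_eqF//.
rewrite divff ?gt_eqF// ger0_norm ?subr_ge0//.
by rewrite lerBlDl -natr1 in t2 *; rewrite ltW// addrC.
Qed.

End MeasurableDensity.

(** * Lower bounds for the probability of many triangles *)

Section MeanTriangleDensity.
Variable R : realType.
Implicit Types (p b eps eta tau : R).

Lemma prod_setU1_ge (E : finType) (w : E -> R) a (S : {set E}) :
  (forall e, 0 <= w e <= 1) ->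
  w a * \prod_(e in S) w e <= \prod_(e in a |: S) w e.
Proof.
move=> w01; have [aS|aS] := boolP (a \in S); last by rewrite big_setU1.
rewrite (_ : a |: S = S); last by apply/finset.setUidPr; rewrite finset.sub1set.
have /andP[? ?] := w01 a.
by rewrite ler_piMl// prodr_ge0// => e _; have /andP[] := w01 e.
Qed.

(** The presence of distinct edges is independent, and when edges coincide the
    mean has fewer factors, all at most 1. *)
Lemma bernoulli_mass_triple (E : finType) (y : E -> R) e1 e2 e3 :
  (forall e, 0 <= y e <= 1) ->
  y e1 * y e2 * y e3 <=
  \sum_(X : {ffun E -> bool}) bernoulli_mass y X * ((X e1)%:R * (X e2)%:R * (X e3)%:R).
Proof.
move=> y01.
apply: (@le_trans _ _ (\prod_(e in e1 |: (e2 |: [set e3])) y e)).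
  apply: le_trans (prod_setU1_ge _ _ y01); rewrite -mulrA ler_wpM2l//.
    by have /andP[] := y01 e1.
  apply: le_trans (prod_setU1_ge _ _ y01); rewrite ler_wpM2l//.
    by have /andP[] := y01 e2.
  by rewrite big_set1.
rewrite -bernoulli_mass_sum_set; apply: ler_sum => X _.
apply: ler_wpM2l; first exact: bernoulli_mass_ge0.
have x01 e : 0 <= ((X e)%:R : R) <= 1 by case: (X e); rewrite ?lexx ?ler01.
have key e : e \in e1 |: (e2 |: [set e3]) -> ~~ X e ->
    \prod_(e' in e1 |: (e2 |: [set e3])) (X e')%:R = 0 :> R.
  by move=> eS Xe; rewrite (bigD1 e)//= (negbTE Xe) mul0r.
have [X1|X1] := boolP (X e1); last by rewrite (key e1) ?inE ?eqxx// !mul0r.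
have [X2|X2] := boolP (X e2); last by rewrite (key e2) ?inE ?eqxx ?orbT// !(mul0r, mulr0).
have [X3|X3] := boolP (X e3); last by rewrite (key e3) ?inE ?eqxx ?orbT// !(mul0r, mulr0).
rewrite !mulr1; apply: prodr_ile1 => e _; exact: x01.
Qed.

Section fixed_n.
Variables (n : nat) (c : 'I_n -> 'I_n -> R).
Hypothesis n0 : (0 < n)%N.
Hypothesis csym : forall i j, c i j = c j i.
Hypothesis c01 : forall i j, 0 <= c i j <= 1.
Let y (e : vertex_pair n) := c (val e).1 (val e).2.
Let T (X : graph n) : R := triangle_density (@graphon_of R n X).

Lemma edge_mx_offdiag (i j : 'I_n) : i != j -> exists e : vertex_pair n,
  (forall z : vertex_pair n -> R, edge_mx z i j = z e) /\ y e = c i j.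
Proof.
rewrite -val_eqE/= neq_ltn => /orP[ij|ji].
  exists (Sub (i, j) ij); split; last by rewrite /y SubK.
  by move=> z; rewrite -[in RHS]edge_mx_val SubK.
exists (Sub (j, i) ji); split; last by rewrite /y SubK/= csym.
by move=> z; rewrite edge_mx_sym -[in RHS]edge_mx_val SubK.
Qed.

Let y01 e : 0 <= y e <= 1. Proof. exact: c01. Qed.

(** The triples of vertices with a repetition, at most [3 * n ^ 2] of them, account
    for the error term. *)
Lemma mean_triangle_density :
  triangle_density (step_graphon c) - 3 * n%:R^-1 <= \sum_X bernoulli_mass y X * T X.
Proof.
have n3 : 0 < n%:R ^+ 3 :> R by rewrite exprn_gt0// ltr0n.
have -> : \sum_X bernoulli_mass y X * T X =
  (\sum_i \sum_j \sum_k \sum_X bernoulli_mass y X *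
    (edge_mx (fun e => (X e)%:R) i j * edge_mx (fun e => (X e)%:R) j k *
     edge_mx (fun e => (X e)%:R) i k)) / n%:R ^+ 3.
  rewrite mulr_suml; under [RHS]eq_bigr do rewrite mulr_suml.
  under [RHS]eq_bigr do under eq_bigr do rewrite mulr_suml.
  under [RHS]eq_bigr do under eq_bigr do under eq_bigr do rewrite mulr_suml.
  under [RHS]eq_bigr do under eq_bigr do rewrite exchange_big/=.
  under [RHS]eq_bigr do rewrite exchange_big/=.
  rewrite [RHS]exchange_big/=; apply: eq_bigr => X _.
  rewrite /T graph_triangle_density// /triangle_sum mulrA mulr_sumr mulr_suml.
  apply: eq_bigr => i _; rewrite mulr_sumr mulr_suml; apply: eq_bigr => j _.
  by rewrite mulr_sumr mulr_suml.
rewrite triangle_density_step// ler_pdivlMr// mulrBl divfK ?gt_eqF//.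
have -> : 3 * n%:R^-1 * n%:R ^+ 3 =
    \sum_(i < n) \sum_(j < n) \sum_(k < n) ((i == j)%:R + (j == k)%:R + (i == k)%:R : R).
  have n0' : n%:R != 0 :> R by rewrite pnatr_eq0 -lt0n.
  have one (i : 'I_n) : \sum_(j < n) (i == j)%:R = 1 :> R.
    by rewrite (bigD1 i)//= eqxx big1 ?addr0// => j ji; rewrite eq_sym (negbTE ji).
  under eq_bigr do under eq_bigr do rewrite !big_split/= !one sumr_const card_ord.
  under eq_bigr do rewrite !big_split/= !sumr_const card_ord sumrMnl one.
  by rewrite sumr_const card_ord; field.
rewrite -sumrB; apply: ler_sum => i _; rewrite -sumrB; apply: ler_sum => j _.
rewrite -sumrB; apply: ler_sum => k _.
have le1 : c i j * c j k * c i k <= 1.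
  by have /andP[] := mulr3_itv01 (c01 i j) (c01 j k) (c01 i k).
have ge0 : 0 <= \sum_X bernoulli_mass y X *
    (edge_mx (fun e => (X e)%:R) i j * edge_mx (fun e => (X e)%:R) j k *
     edge_mx (fun e => (X e)%:R) i k) :> R.
  apply: sumr_ge0 => X _; rewrite mulr_ge0 ?bernoulli_mass_ge0//.
  have e0 i' j' : 0 <= edge_mx (fun e => (X e)%:R) i' j' :> R by exact: sumr_ge0.
  by rewrite !mulr_ge0.
have [ij|ij] := eqVneq i j.
  by apply: le_trans ge0; case: (_ == k); case: (_ == k); rewrite ?mulr0n ?mulr1n; lra.
have [jk|jk] := eqVneq j k.
  by apply: le_trans ge0; case: (_ == k); rewrite ?mulr0n ?mulr1n; lra.
have [ik|ik] := eqVneq i k.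
  by apply: le_trans ge0; rewrite ?mulr0n ?mulr1n; lra.
have [e1 [h1 <-]] := edge_mx_offdiag ij; have [e2 [h2 <-]] := edge_mx_offdiag jk.
have [e3 [h3 <-]] := edge_mx_offdiag ik.
rewrite !addr0 subr0; apply: le_trans (bernoulli_mass_triple e1 e2 e3 y01) _.
by apply: ler_sum => X _; rewrite h1 h2 h3.
Qed.

(** The two sides differ by the diagonal terms, which are nonnegative. *)
Lemma sum_rate_le p : 0 < p < 1 ->
  2 * \sum_e rate p (y e) <= n%:R ^+ 2 * graphon_rate p (step_graphon c).
Proof.
move=> p01; have n2 : 0 < n%:R ^+ 2 :> R by rewrite exprn_gt0// ltr0n.
rewrite graphon_rate_step// [leRHS]mulrC divfK ?gt_eqF// -[leRHS]addr0.
rewrite -(lerD2l (n%:R * rate p 0)) -sum_edge_mx addr0 mulr_natl.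
rewrite (_ : rate p 0 *+ n = \sum_(i < n) rate p 0); last first.
  by rewrite sumr_const card_ord.
rewrite -big_split/=; apply: ler_sum => i _.
rewrite (bigD1 i)//= [X in _ <= _ + X](bigD1 i)//= edge_mx_diag.
rewrite lerD2l -[leLHS]add0r lerD ?rate_ge0//.
apply: ler_sum => j ji; rewrite eq_sym in ji.
by have [e [-> <-]] := edge_mx_offdiag ji.
Qed.

End fixed_n.
End MeanTriangleDensity.

Section ChangeOfMeasure.
Variable R : realType.
Implicit Types (p b eps eta tau : R).

Lemma card_vertex_pair n : n%:R ^+ 2 = n%:R + 2 * #|{: vertex_pair n}|%:R :> R.
Proof.
have := @sum_edge_mx R n (fun=> 0) (fun=> 1).
rewrite !sumr_const !card_ord mulr1 => <-.
by rewrite -mulrnA mulnn natrX.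
Qed.

(** Under the product law of means [c] the event has probability at least
    [eta - 3 / n], because the triangle density is at most 1 and its mean exceeds
    [tau] by that much.  Off an exceptional event of exponentially small
    probability the log-likelihood ratio is at most its mean, bounded by
    [sum_rate_le], plus [eps] per edge. *)
Lemma change_of_measure n p b C eps eta tau (c : 'I_n -> 'I_n -> R) :
  (0 < n)%N -> 0 < p < 1 -> 0 < b -> 0 < C -> 0 < eps <= 2 * C ->
  (forall w, b <= w <= 1 - b -> `|ln (w / p)| <= C / 2 /\
     `|ln (w / (1 - p))| <= C / 2) ->
  (forall i j, c i j = c j i) -> (forall i j, b <= c i j <= 1 - b) ->
  0 <= tau -> tau + eta <= triangle_density (step_graphon c) ->
  expR (- (n%:R ^+ 2 * graphon_rate p (step_graphon c) +
           eps * #|{: vertex_pair n}|%:R)) *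
    (eta - 3 * n%:R^-1 -
     expR (- (eps ^+ 2 / (8 * C ^+ 2) * #|{: vertex_pair n}|%:R))) <=
  \sum_X bernoulli_mass (fun=> p) X *
    (tau <= triangle_density (@graphon_of R n X))%R%:R.
Proof.
move=> n0 p01 b0 C0 epsC hC csym cb tau0 htau; set N : R := #|_|%:R.
have c01 i j : 0 <= c i j <= 1 by have := cb i j; lra.
pose y (e : vertex_pair n) := c (val e).1 (val e).2.
have yb e : b <= y e <= 1 - b by exact: cb.
have y01 e : 0 <= y e <= 1 by exact: c01.
have y01' e : 0 < y e < 1 by have := yb e; lra.
pose T (X : graph n) : R := triangle_density (@graphon_of R n X).
pose Z e (s : bool) := if s then ln (y e / p) else ln ((1 - y e) / (1 - p)).
pose W e s := Z e s - 2 * rate p (y e).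
have ZC e s : `|Z e s| <= C / 2.
  rewrite /Z; case: s; first by case: (hC _ (yb e)).
  by have [] : `|ln ((1 - y e) / p)| <= C / 2 /\ `|ln ((1 - y e) / (1 - p))| <= C / 2
    by apply: hC; have := yb e; lra.
have rateE e : 2 * rate p (y e) = y e * Z e true + (1 - y e) * Z e false.
  by rewrite /rate mulrA divff// mul1r.
have WC e s : `|W e s| <= C.
  rewrite /W (splitr C); apply: (le_trans (ler_normB _ _)); apply: lerD => //.
  rewrite rateE; apply: (le_trans (ler_normD _ _)); rewrite !normrM.
  have /andP[y0 y1] := y01 e; rewrite (ger0_norm y0) (@ger0_norm _ (1 - y e)) ?subr_ge0//.
  have := ler_wpM2l y0 (ZC e true).
  have := @ler_wpM2l _ (1 - y e) _ _ _ (ZC e false); rewrite subr_ge0 => /(_ y1).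
  lra.
have Wc e : y e * W e true + (1 - y e) * W e false = 0 by rewrite /W rateE; ring.
have chern := chernoff C0 epsC y01 WC Wc; rewrite -/N in chern.
pose q X := bernoulli_mass y X.
have q0 X : 0 <= q X by exact: bernoulli_mass_ge0.
set B := expR (- (_ + eps * N)); set ex := expR (- (_ * N)) in chern *.
have mean := mean_triangle_density n0 csym c01; rewrite -/y in mean.
have qA : eta - 3 * n%:R^-1 <= \sum_X q X * (tau <= T X)%R%:R.
  have : \sum_X q X * T X <= \sum_X q X * (tau + (tau <= T X)%R%:R).
    apply: ler_sum => X _; apply: ler_wpM2l => //.
    case: (leP tau (T X)) => h /=; last by rewrite addr0 ltW.
    by have /andP[_ T1] := triangle_density01 (graphons_graphon_of R X n0); rewrite mulr1n (le_trans T1)// lerDr.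
  have -> : \sum_X q X * (tau + (tau <= T X)%R%:R) =
      tau + \sum_X q X * (tau <= T X)%R%:R.
    have E : tau = \sum_X q X * tau.
      by rewrite -mulr_suml bernoulli_mass_sum mul1r.
    rewrite [Y in _ = Y + _]E -big_split/=.
    by apply: eq_bigr => X _; rewrite mulrDr.
  rewrite /T /q in mean *; move: mean htau.
  by move: (\sum_X _) (\sum_X _) (triangle_density _) => s1 s2 s3; lra.
apply: (@le_trans _ _ (B * \sum_X (q X * (tau <= T X)%R%:R -
    q X * (eps * N <= \sum_e W e (X e))%R%:R))).
  apply: ler_wpM2l; first exact: expR_ge0.
  by rewrite sumrB; apply: lerB => //.
rewrite mulr_sumr; apply: ler_sum => X _; rewrite -/(T X).
have yX e : if X e then 0 < y e else y e < 1.
  by have /andP[? ?] := y01' e; case: (X e).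
have PqE : q X = bernoulli_mass (fun=> p) X * expR (loglik p y X).
  exact: bernoulli_mass_loglik.
have P0 : 0 < bernoulli_mass (fun=> p) X by exact: bernoulli_mass_gt0.
case: (leP tau (T X)) => hT; case: (leP (eps * N)) => hW;
  rewrite /= ?(mulr1, mulr0, subrr, subr0, sub0r).
- exact: ltW.
- rewrite PqE mulrCA -[leRHS]mulr1 ler_pM2l// /B -expRD -[leRHS]expR0 ler_expR.
  have llE : loglik p y X = \sum_e W e (X e) + 2 * \sum_e rate p (y e).
    by rewrite mulr_sumr -big_split/=; apply: eq_bigr => e _; rewrite /W subrK.
  have := sum_rate_le n0 csym c01 p01; rewrite -/y llE; lra.
- by rewrite mulrN oppr_le0 mulr_ge0// expR_ge0.
- by [].
Qed.

(** The estimate of [change_of_measure] for large [n]: half of [eps] pays for the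
    fluctuations of the likelihood and half for the constant prefactor. *)
Lemma finite_lower p b eps eta : 0 < p < 1 -> 0 < b -> 0 < eps -> 0 < eta ->
  \forall n \near \oo, forall (c : 'I_n -> 'I_n -> R) tau,
    (forall i j, c i j = c j i) -> (forall i j, b <= c i j <= 1 - b) ->
    0 <= tau -> tau + eta <= triangle_density (step_graphon c) ->
    expR (- (n%:R ^+ 2 * (graphon_rate p (step_graphon c) + eps))) <=
    \sum_X bernoulli_mass (fun=> p) X *
      (tau <= triangle_density (@graphon_of R n X))%R%:R.
Proof.
move=> p01 b0 eps0 eta0; have /andP[p0 p1] := p01.
have [Ca Ca0 hCa] := ln_ratio_bounded b0 p0.
have [Cb Cb0 hCb] := @ln_ratio_bounded R b (1 - p) b0 ltac:(lra).
pose C := 2 * (Ca + Cb) + 1.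
have C0 : 0 < C by rewrite /C; lra.
have hC w : b <= w <= 1 - b -> `|ln (w / p)| <= C / 2 /\ `|ln (w / (1 - p))| <= C / 2.
  by move=> wb; have := hCa _ wb; have := hCb _ wb; rewrite /C; split; lra.
pose eps1 := Num.min eps C.
have eps10 : 0 < eps1 by rewrite lt_min eps0.
have epsC : 0 < eps1 <= 2 * C.
  by rewrite eps10/=; apply: (@le_trans _ _ C); [rewrite ge_min lexx orbT|lra].
have eps1e : eps1 <= eps by rewrite ge_min lexx.
pose c0 := eps1 ^+ 2 / (8 * C ^+ 2).
have c00 : 0 < c0 by rewrite divr_gt0 ?exprn_gt0// mulr_gt0// exprn_gt0.
near=> n => c tau csym cb tau0 htau.
have n0 : (0 < n)%N by near: n; exists 1%N.
have n0' : 0 < n%:R :> R by rewrite ltr0n.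
have inv_le (d : R) : n%:R^-1 <= d -> 1 <= d * n%:R.
  by move=> h; have := ler_wpM2r (ltW n0') h; rewrite mulVf ?gt_eqF.
have h1 : n%:R^-1 <= 2^-1 :> R by near: n; exact: near_inv_le.
have h2 : n%:R^-1 <= eta / 12 by near: n; apply: near_inv_le; rewrite divr_gt0.
have h3 : n%:R^-1 <= c0 * eta / 16.
  by near: n; apply: near_inv_le; rewrite divr_gt0// mulr_gt0.
have h4 : n%:R^-1 <= eta * eps / 8.
  by near: n; apply: near_inv_le; rewrite divr_gt0// mulr_gt0.
have := change_of_measure n0 p01 b0 C0 epsC hC csym cb tau0 htau.
rewrite /= -/c0; set N : R := #|_|%:R => H; apply: le_trans H.
clear hC htau csym cb.
have NE := card_vertex_pair n; rewrite -/N in NE.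
have h1' := inv_le _ h1.
have h3' := inv_le _ h3.
have h4' := inv_le _ h4.
have n1 : n%:R <= n%:R ^+ 2 :> R by rewrite expr2 ler_peMl ?ler1n// ltW.
have nn2 : 2 * n%:R <= n%:R ^+ 2 :> R by rewrite expr2 ler_wpM2r ?(ltW n0')//; lra.
have N0 : 0 <= N by [].
have exb : expR (- (c0 * N)) <= eta / 4.
  rewrite expRN -[leRHS]invrK lef_pV2 ?posrE ?expR_gt0 ?invr_gt0 ?divr_gt0//.
  apply: le_trans (expR_ge1Dx _).
  have : n%:R ^+ 2 / 4 <= N by lra.
  move=> /(ler_wpM2l (ltW c00)) hN.
  have : 1 <= eta / 4 * (c0 * N).
    have := ler_wpM2l (ltW eta0) hN; have := ler_wpM2l (ltW c00) n1.
    move=> /(ler_wpM2l (ltW eta0)); lra.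
  rewrite invf_div ler_pdivrMr//; lra.
have exb2 : expR (- (n%:R ^+ 2 * eps / 2)) <= eta / 4.
  rewrite expRN -[leRHS]invrK lef_pV2 ?posrE ?expR_gt0 ?invr_gt0 ?divr_gt0//.
  apply: le_trans (expR_ge1Dx _).
  have : 1 <= eta / 4 * (n%:R ^+ 2 * eps / 2).
    have := ler_wpM2l (ltW eps0) n1; move=> /(ler_wpM2l (ltW eta0)); lra.
  rewrite invf_div ler_pdivrMr//; lra.
apply: (@le_trans _ _ (expR (- (n%:R ^+ 2 * graphon_rate p (step_graphon c) + eps1 * N)) *
   expR (- (n%:R ^+ 2 * eps / 2)))).
  rewrite -expRD ler_expR.
  have : eps1 * N <= eps * N by exact: ler_wpM2r.
  have := ler_wpM2l (ltW eps0) (_ : N <= n%:R ^+ 2 / 2); lra.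
apply: ler_wpM2l; first exact: expR_ge0.
lra.
Unshelve. all: by end_near. Qed.

End ChangeOfMeasure.

Section Perturbation.
Variable R : realType.
Implicit Types (p t eps : R) (f : R * R -> R).

(** Without [d] this is [a * b * c >= (1 - s ^ 3) * u * v * w + s ^ 3] for
    [a = (1 - s) * u + s] and so on, since products of numbers in [0, 1] are
    below their factors; lowering each of three factors of size at most 1 by [d]
    costs at most [3 * d]. *)
Lemma product_shift_ge (s d u v w : R) : 0 <= s <= 1 -> 0 <= d ->
  0 <= u <= 1 -> 0 <= v <= 1 -> 0 <= w <= 1 -> d <= s ->
  (1 - s ^+ 3) * (u * v * w) + s ^+ 3 - 3 * d <=
  ((1 - s) * u + (s - d)) * ((1 - s) * v + (s - d)) * ((1 - s) * w + (s - d)).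
Proof.
move=> /andP[s0 s1] d0 /andP[u0 u1] /andP[v0 v1] /andP[w0 w1] ds.
have s1' : 0 <= 1 - s by lra.
have aff (x : R) : 0 <= x -> x <= 1 -> 0 <= (1 - s) * x + s <= 1 /\
    0 <= (1 - s) * x + (s - d).
  by move=> x0 x1; have := mulr_ge0 s1' x0; have := ler_wpM2l s1' x1; lra.
have [/andP[a0 a1] a'] := aff _ u0 u1; have [/andP[b0 b1] b'] := aff _ v0 v1.
have [/andP[c0 c1] c'] := aff _ w0 w1.
set a := (1 - s) * u + s in a0 a1 *; set b := (1 - s) * v + s in b0 b1 *.
set c := (1 - s) * w + s in c0 c1 *.
apply: (@le_trans _ _ (a * b * c - 3 * d)).
  rewrite lerD2r /a /b /c.
  have uv := mulr_ge0 u0 v0; have vw := mulr_ge0 v0 w0; have uw := mulr_ge0 u0 w0.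
  have e1 : u * v * w <= u * v by rewrite ler_piMr.
  have e2 : u * v * w <= v * w by rewrite -mulrA ler_piMl.
  have e3 : u * v * w <= u * w by rewrite mulrAC ler_piMr.
  have e4 : u * v * w <= u by apply: (le_trans e1); rewrite ler_piMr.
  have e5 : u * v * w <= v by apply: (le_trans e2); rewrite ler_piMr.
  have e6 : u * v * w <= w by apply: (le_trans e2); rewrite ler_piMl.
  have k1 : 0 <= (1 - s) ^+ 2 * s by rewrite mulr_ge0 ?exprn_ge0.
  have k2 : 0 <= (1 - s) * s ^+ 2 by rewrite mulr_ge0 ?exprn_ge0.
  rewrite -subr_ge0.
  rewrite (_ : _ - _ = (1 - s) ^+ 2 * s * ((u * v - u * v * w) + (v * w - u * v * w) + (u * w - u * v * w)) +
    (1 - s) * s ^+ 2 * ((u - u * v * w) + (v - u * v * w) + (w - u * v * w))); last by ring.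
  by rewrite addr_ge0// mulr_ge0//; lra.
have aE : (1 - s) * u + (s - d) = a - d by rewrite /a; ring.
have bE : (1 - s) * v + (s - d) = b - d by rewrite /b; ring.
have cE : (1 - s) * w + (s - d) = c - d by rewrite /c; ring.
rewrite aE in a' *; rewrite bE in b' *; rewrite cE in c' *.
rewrite -subr_ge0.
have -> : (a - d) * (b - d) * (c - d) - (a * b * c - 3 * d) =
  d * ((1 - b * c) + (1 - (a - d) * c) + (1 - (a - d) * (b - d))) by ring.
apply: mulr_ge0 => //.
have bc1 : b * c <= 1 by rewrite mulr_ile1.
have ac1 : (a - d) * c <= 1 by rewrite mulr_ile1//; lra.
have ab1 : (a - d) * (b - d) <= 1 by rewrite mulr_ile1//; lra.
lra.
Qed.

(** [r] is the weight of the constant graphon that is mixed in and [d] keeps the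
    mixture away from 1.  The relation between them makes the loss [3 * d] of
    [product_shift_ge] half of the gain [r ^ 3 * (1 - t ^ 3)]. *)
Lemma perturbation_parameters t eps (B : R) : 0 < t < 1 -> 0 < eps -> 0 <= B ->
  exists r d : R, [/\ 0 < r <= 2^-1, 0 < d < r, r * B <= eps &
    6 * d = r ^+ 3 * (1 - t ^+ 3)].
Proof.
move=> /andP[t0 t1] eps0 B0.
pose r := Num.min 2^-1 (eps / (B + 1)).
have r0 : 0 < r by rewrite lt_min invr_gt0 ltr0n/= divr_gt0//; lra.
have r2 : r <= 2^-1 by rewrite ge_min lexx.
have rB : r * B <= eps.
  have : r <= eps / (B + 1) by rewrite ge_min lexx orbT.
  rewrite ler_pdivlMr; last by lra.
  by apply: le_trans; rewrite ler_pM2l//; lra.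
have t3 : 0 < 1 - t ^+ 3 by rewrite subr_gt0 exprn_ilt1 ?(ltW t0).
have t3' : 1 - t ^+ 3 <= 1 by have := exprn_gt0 3 t0; lra.
have r3 : 0 < r ^+ 3 by rewrite exprn_gt0.
exists r, (r ^+ 3 * (1 - t ^+ 3) / 6); split => //.
- by rewrite r0.
- rewrite divr_gt0 ?mulr_gt0//=.
  have : r ^+ 3 <= r by rewrite exprS ler_piMr ?(ltW r0)// exprn_ile1 ?(ltW r0)//; lra.
  have : r ^+ 3 * (1 - t ^+ 3) <= r ^+ 3 by rewrite ler_piMr ?(ltW r3).
  lra.
- by field.
Qed.

(** Mixing in a constant slightly below 1 raises the triangle density by a fixed
    amount, keeps the values away from 0 and 1, and by convexity of the rate costs
    little. *)
Lemma perturb_graphon p t eps f : 0 < p < 1 -> 0 < t < 1 -> upper_tail t f -> 0 < eps ->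
  exists (f1 : R * R -> R) (b eta : R),
  [/\ measurable_fun setT f1, 0 < b < 2^-1, 0 < eta,
      (forall z, b <= f1 z <= 1 - b) &
      [/\ forall x y, 0 <= x < 1 -> 0 <= y < 1 -> f1 (x, y) = f1 (y, x),
      t ^+ 3 + eta <= triangle_density f1 &
      graphon_rate p f1 <= graphon_rate p f + eps]].
Proof.
move=> p01 t01 [gf Tf] eps0.
have [F [mF F01 Fsym TF IF]] := restrict_graphon gf.
rewrite -(IF p) -TF in Tf *; clear IF TF gf f; move: Tf.
pose B := 2^-1 * (- ln p - ln (1 - p)).
have B0 : 0 <= B.
  by apply: le_trans (rate_bounded p01 (_ : 0 <= 1 <= 1)); rewrite ?rate_ge0 ?lexx ?ler01.
have [r [d [/andP[r0 r2] /andP[d0 dr] rB dE]]] := perturbation_parameters t01 eps0 B0.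
have r31 : 0 <= 1 - r ^+ 3 by rewrite subr_ge0 exprn_ile1 ?(ltW r0)//; lra.
have r1 : 0 <= 1 - r by lra.
pose b := Num.min (r - d) d.
have b0 : 0 < b by rewrite lt_min subr_gt0 dr.
have b_rd : b <= r - d by rewrite ge_min lexx.
have b_d : b <= d by rewrite ge_min lexx orbT.
have b2 : b < 2^-1 by lra.
have eta0 : 0 < 3 * d by lra.
pose f1 z := (1 - r) * F z + (r - d).
have f1b z : b <= f1 z <= 1 - b.
  have /andP[F0 F1] := F01 z.
  by have := ler_wpM2l r1 F0; have := ler_wpM2l r1 F1; rewrite /f1; lra.
have f101 z : 0 <= f1 z <= 1 by have := f1b z; lra.
have rc : r * ((r - d) / r) = r - d by rewrite mulrC divfK// gt_eqF.
have c01 : 0 <= (r - d) / r <= 1.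
  by rewrite divr_ge0 ?subr_ge0 ?(ltW dr) ?(ltW r0)//= ler_pdivrMr// mul1r; lra.
have r01 : 0 <= r <= 1 by lra.
have bF := bounded_measurable01 mF F01.
have mf1 : measurable_fun setT f1.
  by apply: measurable_funD => //; exact: measurable_funM.
have bf1 := bounded_measurable01 mf1 f101.
have shift z1 z2 z3 : (1 - r ^+ 3) * (F z1 * F z2 * F z3) + (r ^+ 3 - 3 * d) <=
    f1 z1 * f1 z2 * f1 z3.
  by rewrite addrA; apply: product_shift_ge => //; exact: ltW.
have convex z : rate p (f1 z) <= rate p (F z) + eps.
  have := @rate_convex R p (F z) ((r - d) / r) r p01 (F01 _) c01 r01.
  rewrite rc -/(f1 z) => cvx; apply: (le_trans (cvx _)).
    by have := f1b z; lra.
  apply: lerD; first by rewrite ler_piMl ?rate_ge0//; lra.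
  by apply: le_trans rB; rewrite ler_pM2l//; exact: rate_bounded.
have final (T : R) : t ^+ 3 <= T ->
    t ^+ 3 + 3 * d <= (1 - r ^+ 3) * T + (r ^+ 3 - 3 * d).
  by move=> Tf; have := ler_wpM2l r31 Tf; lra.
move=> Tf; exists f1, b, (3 * d); split.
- exact: mf1.
- by rewrite b0.
- exact: eta0.
- exact: f1b.
split.
- by move=> x y x01 y01; rewrite /f1 Fsym.
- have bT := triangle_integrand_measurable bF bF bF.
  have bT1 := triangle_integrand_measurable bf1 bf1 bf1.
  have bZ := bounded_measurableM (bounded_measurable_cst _ (1 - r ^+ 3)) bT.
  have bC := bounded_measurable_cst (R * R * R)%type (r ^+ 3 - 3 * d).
  apply: (le_trans (final _ Tf)).
  rewrite (triangle_densityE F) -(int3Z _ bT) -(int3_cst (r ^+ 3 - 3 * d)).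
  rewrite -(int3D bZ bC) triangle_densityE.
  by apply: (int3_le (bounded_measurableD bZ bC) bT1) => x y z _ _ _; exact: shift.
- rewrite !graphon_rateE.
  have bRF := bounded_measurable_rate p01 mF F01.
  have bR1 := bounded_measurable_rate p01 mf1 f101.
  have bC := bounded_measurable_cst (R * R)%type eps.
  rewrite -(int2_cst eps) -(int2D bRF bC).
  by apply: (int2_le bR1 (bounded_measurableD bRF bC)) => x y _ _; exact: convex.
Qed.

End Perturbation.

Section UpperTail.
Variable R : realType.
Implicit Types (p t eps : R) (f : R * R -> R).

Lemma dist_midpoint_le (u v w : R) :
  `|u - (v + w) / 2| <= 2^-1 * `|u - v| + 2^-1 * `|u - w|.
Proof.
rewrite (_ : u - (v + w) / 2 = 2^-1 * (u - v) + 2^-1 * (u - w)); last by field.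
by rewrite (le_trans (ler_normD _ _))// !normrM (@ger0_norm _ 2^-1).
Qed.

(** The distance is invariant under exchange of the coordinates, and the midpoint
    of two approximants is at most as far as their average distance. *)
Lemma L1dist_symmetrize n f (c : 'I_n -> 'I_n -> R) : (0 < n)%N ->
  bounded_measurable f ->
  (forall x y, 0 <= x < 1 -> 0 <= y < 1 -> f (x, y) = f (y, x)) ->
  L1dist f (step_graphon (fun i j => (c i j + c j i) / 2)) <=
  L1dist f (step_graphon c).
Proof.
move=> n0 bf fsym.
have bc := bounded_measurable_step_graphon n0 c.
have bc' := bounded_measurable_step_graphon n0 (fun i j => (c i j + c j i) / 2).
have bfs := bounded_measurable_swap bf; have bcs := bounded_measurable_swap bc.
have sw : L1dist (fun z => f (z.2, z.1)) (fun z => step_graphon c (z.2, z.1)) =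
    L1dist f (step_graphon c).
  exact: (esym (int01_swap (L1dist_measurable bf bc))).
have := @L1dist_le_co R _ _ _ _ _ _ 2^-1 2^-1 bf bc' bf bc bfs bcs.
rewrite sw; move: (L1dist f (step_graphon c)) (L1dist f _) => D D' h.
have -> : D = 2^-1 * D + 2^-1 * D by clear; lra.
apply: h => x y x01 y01; have fs := fsym x y x01 y01.
rewrite [(x, y).1]/= [(x, y).2]/= -fs; clear fs.
have [i ix] := cell_cover n0 x01; have [j jy] := cell_cover n0 y01.
rewrite !(step_graphonE _ ix jy) (step_graphonE _ jy ix).
move: (f _) (c i j) (c j i) => u v w.
exact: dist_midpoint_le.
Qed.

Lemma graphon_rate_lipschitz n p b C f (c : 'I_n -> 'I_n -> R) : (0 < n)%N ->
  0 < p < 1 -> 0 < b -> 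
  (forall u v, b <= u <= 1 - b -> b <= v <= 1 - b ->
    rate p u - rate p v <= C * `|u - v|) ->
  measurable_fun setT f -> (forall z, b <= f z <= 1 - b) ->
  (forall i j, b <= c i j <= 1 - b) ->
  graphon_rate p (step_graphon c) <=
  graphon_rate p f + C * L1dist f (step_graphon c).
Proof.
move=> n0 p01 b0 hC mf fb cb; rewrite !graphon_rateE.
have f01 z : 0 <= f z <= 1 by have := fb z; lra.
have c01 i j : 0 <= c i j <= 1 by have := cb i j; lra.
have bf := bounded_measurable01 mf f01.
have bc := bounded_measurable_step_graphon n0 c.
have bRf := bounded_measurable_rate p01 mf f01.
have zero01 : 0 <= (0 : R) <= 1 by rewrite lexx ler01.
have bRc := bounded_measurable_rate p01 (measurable_step_graphon c)
  (step_graphon_ind n0 (P := fun r => 0 <= r <= 1) zero01 c01).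
have bL := L1dist_measurable bf bc.
have bCL := bounded_measurableM (bounded_measurable_cst _ C) bL.
rewrite -(int2Z C bL) -(int2D bRf bCL).
apply: (int2_le_co bRc (bounded_measurableD bRf bCL)) => x y x01 y01.
have [i ix] := cell_cover n0 x01; have [j jy] := cell_cover n0 y01.
by rewrite (step_graphonE _ ix jy) -lerBlDl distrC; exact: hC.
Qed.

(** The perturbed graphon is replaced by a symmetric step function with values away
    from 0 and 1.  Triangle density and rate are Lipschitz in L^1 there, so both
    are almost kept, and [finite_lower] applies. *)
Theorem upper_tail_lower p t eps f : 0 < p < 1 -> 0 < t < 1 ->
  upper_tail t f -> 0 < eps ->
  \forall n \near \oo,
    expR (- (n%:R ^+ 2 * (graphon_rate p f + eps))) <=
    \sum_(X : graph n) bernoulli_mass (fun=> p) X *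
      (t ^+ 3 <= triangle_density (@graphon_of R n X))%R%:R.
Proof.
move=> p01 t01 tf eps0; have eps3 : 0 < eps / 3 by rewrite divr_gt0.
have [f1 [b [eta [mf1 /andP[b0 b2] eta0 f1b [f1sym Tf1 If1]]]]] :=
  perturb_graphon p01 t01 tf eps3.
have t3 : 0 <= t ^+ 3 by rewrite exprn_ge0//; case/andP: t01 => /ltW.
clear tf t01; move: (graphon_rate p f) (t ^+ 3) t3 Tf1 If1 => I0 t3 t30 Tf1 If1.
have [C C0 hC] := rate_lipschitz p01 b0.
have f101 z : 0 <= f1 z <= 1 by have := f1b z; clear -b0; lra.
have bf1 := bounded_measurable01 mf1 f101.
pose delta := Num.min (eta / 6) (eps / (3 * (C + 1))).
have delta0 : 0 < delta.
  by rewrite lt_min !divr_gt0// mulr_gt0//; clear -C0; lra.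
have delta_eta : 3 * delta <= eta / 2.
  have : delta <= eta / 6 by rewrite ge_min lexx.
  by clear; lra.
have delta_eps : C * delta <= eps / 3.
  have : delta <= eps / (3 * (C + 1)) by rewrite ge_min lexx orbT.
  rewrite ler_pdivlMr; last by rewrite mulr_gt0//; clear -C0; lra.
  by move: delta0; clear -C0; lra.
have lohi : b <= 1 - b by clear -b2; lra.
have eta2 : 0 < eta / 2 by rewrite divr_gt0.
have f1b' x y (_ : 0 <= x < 1) (_ : 0 <= y < 1) := f1b (x, y).
apply: filterS3 (nbhs_infty_gt 0)
  (approximable_clip lohi bf1 f1b' (approximable_measurable mf1 f101) delta0)
  (finite_lower p01 b0 eps3 eta2) => n n0 [c cb hc] lower.
pose c' i j := (c i j + c j i) / 2.
have c'sym i j : c' i j = c' j i by rewrite /c' addrC.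
have c'b i j : b <= c' i j <= 1 - b.
  by have := cb i j; have := cb j i; rewrite /c'; clear; lra.
have hc' : L1dist f1 (step_graphon c') <= delta.
  exact: le_trans (L1dist_symmetrize c n0 bf1 f1sym) hc.
have c'01 i j : 0 <= c' i j <= 1 by have := c'b i j; clear -b0; lra.
have Ic' := graphon_rate_lipschitz n0 p01 b0 hC mf1 f1b c'b.
have f1N z : `|f1 z| <= 1 by have /andP[F0 F1] := f101 z; rewrite (ger0_norm F0).
have c'N z : `|step_graphon c' z| <= 1.
  apply: (step_graphon_ind n0 (P := fun r => `|r| <= 1)).
    by rewrite normr0.
  by move=> i j; have /andP[F0 F1] := c'01 i j; rewrite (ger0_norm F0).
have Tc' := triangle_density_lipschitz bf1 (bounded_measurable_step_graphon n0 c') f1N c'N.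
rewrite -/(L1dist f1 (step_graphon c')) in Tc'.
apply: le_trans (lower c' t3 c'sym c'b t30 _); last first.
  move: Tc' hc' Tf1.
  move: (L1dist _ _) (triangle_density f1) (triangle_density _) => D T1 T2.
  move=> /(le_trans (ler_norm _)); move: delta_eta; clear; lra.
have n2 : 0 <= n%:R ^+ 2 :> R by exact: sqr_ge0.
rewrite ler_expR lerN2; apply: ler_wpM2l => //.
move: Ic' hc' If1 delta_eps.
move: (L1dist _ _) (graphon_rate p f1) (graphon_rate _ _) => D I1 I2 h hD h1 h2.
have := ler_wpM2l C0 hD; clear -h h1 h2; lra.
Qed.

End UpperTail.

(** * The tangent line to the rate function *)

Section LocalMinimum.
Variable R : realType.

(** Fermat's criterion with differentiability at the single point [t]: the
    difference quotient at a small increment of sign opposite to the derivative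
    would have the wrong sign. *)
Lemma derive1_local_min (h : R -> R) (t e0 : R) : 0 < e0 ->
  (forall s, `|s| < e0 -> h t <= h (t + s)) -> derivable h t 1 -> derive1 h t = 0.
Proof.
move=> e00 hmin dh; rewrite derive1E; set d := 'D_1 h t.
have cv : (s^-1 *: ((h \o shift t) (s *: 1) - h t)) @[s --> 0^'] --> d by exact: dh.
apply/eqP; apply: contraT => d0.
have nd : 0 < `|d| by rewrite normr_gt0.
have /cvgrPdist_le/(_ _ (_ : 0 < `|d| / 2)) := cv.
move=> /(_ ltac:(by rewrite divr_gt0)) [e /= ee0 he].
pose m := Num.min e e0 / 2.
have m0 : 0 < m by rewrite divr_gt0// lt_min ee0.
have me : m < e.
  have : Num.min e e0 <= e by rewrite ge_min lexx.
  by move: m0; rewrite /m; lra.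
have me0 : m < e0.
  have : Num.min e e0 <= e0 by rewrite ge_min lexx orbT.
  by move: m0; rewrite /m; lra.
(* The increment has the sign opposite to d. *)
pose s := if 0 < d then - m else m.
have sm : `|s| = m by rewrite /s; case: ifP => _; rewrite ?normrN gtr0_norm.
have s0 : s != 0 by rewrite -normr_gt0 sm.
have /= := he s; rewrite /ball/= sub0r normrN sm => /(_ me s0).
rewrite /shift/= scaler1 [s + t]addrC.
have := hmin s; rewrite sm => /(_ me0); rewrite -subr_ge0.
move: (h (t + s) - h t) => q q0; rewrite /GRing.scale/=.
case: (ltgtP 0 d) d0 => // dd _; move: s0 sm; rewrite /s ?dd => _ _.
  have -> : (- m)^-1 * q = - (m^-1 * q) by rewrite invrN mulNr.
  have : 0 <= m^-1 * q by rewrite mulr_ge0// invr_ge0 ltW.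
  rewrite opprK; move: (m^-1 * q) => z z0.
  by rewrite !gtr0_norm//; lra.
rewrite ltNge (ltW dd)/=.
have : 0 <= m^-1 * q by rewrite mulr_ge0// invr_ge0 ltW.
move: (m^-1 * q) => z z0.
by rewrite !ltr0_norm//; lra.
Qed.

End LocalMinimum.

Section Phi.
Variable R : realType.
Implicit Types (p t u alpha beta : R) (f : R * R -> R).

Lemma graphon_rate_ge0 p f : 0 < p < 1 -> graphons f -> 0 <= graphon_rate p f.
Proof.
move=> p01 [_ _ f01]; rewrite graphon_rateE /int2.
apply: int01_ge0 => x x01; apply: int01_ge0 => y y01.
by apply: rate_ge0 => //; exact: f01.
Qed.

Lemma phi_ge0 p u : 0 < p < 1 -> 0 <= phi p u.
Proof.
move=> p01; rewrite /phi; set S := [set _ | _ in _].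
have [->|/set0P ne] := eqVneq S set0; first by rewrite inf0.
by apply: lb_le_inf => // _ [f [gf _] <-]; exact: graphon_rate_ge0.
Qed.

Lemma phi_le p u f : 0 < p < 1 -> graphons f -> triangle_density f = u ^+ 3 ->
  phi p u <= graphon_rate p f.
Proof.
move=> p01 gf fu; apply: ge_inf; last by exists f.
by exists 0 => _ [g [gg _] <-]; exact: graphon_rate_ge0.
Qed.

Lemma constant_graphon u : 0 <= u <= 1 ->
  [/\ graphons (fun=> u : R), triangle_density (fun=> u) = u ^+ 3 &
    forall p, graphon_rate p (fun=> u) = rate p u].
Proof.
move=> u01; split.
- by split => //; exact: measurable_cst.
- by rewrite triangle_densityE int3_cst !exprS expr0 mulr1 mulrA.
- by move=> p; rewrite graphon_rateE int2_cst.
Qed.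

Lemma phi_pp p : 0 < p < 1 -> phi p p = 0.
Proof.
move=> p01; apply/le_anti/andP; split; last exact: phi_ge0.
have [|gp Tp Ip] := @constant_graphon p; first by case/andP: p01 => *; rewrite !ltW.
by rewrite -(rate_pp p01) -Ip; exact: phi_le.
Qed.

Section tangent.
Variables p t alpha beta : R.
Hypotheses (hp : 0 < p) (hpt : p < t) (ht : t < 1).
Hypothesis halpha0 : 0 < alpha.
Hypothesis hminorant : minorant_condition p t alpha.
Hypothesis hbeta : subdifferential (convex_minorant (rescaled_phi p alpha))
               (t `^ (3 * alpha)) (beta / 6).

Let p01 : 0 < p < 1. Proof. by rewrite hp (lt_trans hpt). Qed.
Let t0 : 0 < t. Proof. exact: lt_trans hpt. Qed.
Let al3 : 0 < 3 * alpha. Proof. by rewrite mulr_gt0. Qed.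

Let rescaled_ge0 x : x \in `[0, 1] -> 0 <= rescaled_phi p alpha x.
Proof. by move=> _; exact: phi_ge0. Qed.

Lemma powR_itv u : 0 <= u <= 1 -> u `^ (3 * alpha) \in `[0, 1].
Proof.
move=> /andP[u0 u1]; rewrite in_itv/= powR_ge0/=.
apply: (@le_trans _ _ (1 `^ (3 * alpha))); last by rewrite powR1.
by apply: ge0_ler_powR; rewrite ?nnegrE ?(ltW al3).
Qed.

Lemma rescaled_phiE u : 0 <= u -> rescaled_phi p alpha (u `^ (3 * alpha)) = phi p u.
Proof. by move=> u0; rewrite /rescaled_phi -powRrM mulfV ?gt_eqF// powRr1. Qed.

(** The supporting line lies below the minorant, hence below the rescaled rate
    function, and it passes through the value at [t] by the minorant
    condition. *)
Lemma phi_tangent u : 0 <= u <= 1 ->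
  phi p t + beta / 6 * (u `^ (3 * alpha) - t `^ (3 * alpha)) <= phi p u.
Proof.
move=> u01; have /andP[u0 u1] := u01.
have [[_ below] _] := convex_minorantP rescaled_ge0.
have := hbeta (powR_itv u01); rewrite hminorant => /le_trans; apply.
by rewrite -[leRHS]rescaled_phiE//; exact: below (powR_itv u01).
Qed.

(** At [p], to the left of [t], the rate function vanishes, while it is nonnegative
    at [t]: a supporting line at [t] cannot decrease. *)
Lemma beta_ge0 : 0 <= beta.
Proof.
have /phi_tangent : 0 <= p <= 1 by case/andP: p01 => *; rewrite !ltW.
rewrite phi_pp// => h; have ph := phi_ge0 t p01.
have pt : p `^ (3 * alpha) < t `^ (3 * alpha).
  by apply: gt0_ltr_powR; rewrite ?nnegrE ?(ltW hp) ?(ltW t0).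
have : 0 <= beta / 6.
  rewrite -(pmulr_lge0 _ (_ : 0 < t `^ (3 * alpha) - p `^ (3 * alpha))) ?subr_gt0//.
  lra.
by rewrite pmulr_lge0// invr_gt0.
Qed.

(** The inequality [phi_tangent] at the cube root of the triangle density of
    [f]. *)
Lemma graphon_tangent f : graphons f ->
  beta / 6 * triangle_density f `^ alpha - graphon_rate p f <=
  beta / 6 * t `^ (3 * alpha) - phi p t.
Proof.
move=> gf; have /andP[T0 T1] := triangle_density01 gf.
set T := triangle_density f in T0 T1 *.
pose u := T `^ 3^-1.
have u0 : 0 <= u by exact: powR_ge0.
have uT : u ^+ 3 = T by rewrite -powR_mulrn// -powRrM mulVf// powRr1.
have u1 : u <= 1.
  apply: (@le_trans _ _ (1 `^ 3^-1)); last by rewrite powR1.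
  by apply: ge0_ler_powR; rewrite ?nnegrE ?invr_ge0.
have uTa : u `^ (3 * alpha) = T `^ alpha by rewrite -powRrM mulrA mulVf// mul1r.
have := phi_tangent (_ : 0 <= u <= 1); rewrite u0 u1 uTa => /(_ isT).
have := @phi_le p u f p01 gf (esym uT).
move: (graphon_rate p f) => I0; lra.
Qed.

(** By [phi_tangent] the point [t] minimises [phi p u - beta / 6 * u ^ (3 alpha)]
    over [0, 1]. *)
Lemma beta_derivative : derivable (phi p) t 1 ->
  beta = 2 * derive1 (phi p) t / (alpha * t `^ (3 * alpha - 1)).
Proof.
move=> dphi.
pose k := 3 * alpha.
pose w (u : R) := u `^ k.
have dpow : is_derive t 1 w (k * t `^ (k - 1)) := is_derive1_powR k t0.
have dph : is_derive t 1 (phi p : R -> R) ('D_1 (phi p) t) by apply: DeriveDef.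
pose h : R -> R := phi p - (beta / 6) *: w.
have dh : is_derive t 1 h ('D_1 (phi p) t - (beta / 6) *: (k * t `^ (k - 1))).
  exact: is_deriveB.
have hE u : h u = phi p u - beta / 6 * u `^ k by [].
have e0 : 0 < Num.min t (1 - t) by rewrite lt_min t0 subr_gt0.
have hmin s : `|s| < Num.min t (1 - t) -> h t <= h (t + s).
  rewrite lt_min => /andP[st s1t].
  have ts01 : 0 <= t + s <= 1.
    by move: st s1t; rewrite !ltr_norml => /andP[? ?] /andP[? ?]; lra.
  by have := phi_tangent ts01; rewrite !hE /k; lra.
have := derive1_local_min e0 hmin (@ex_derive _ _ _ _ _ _ _ dh).
rewrite derive1E (@derive_val _ _ _ _ _ _ _ dh) -derive1E /GRing.scale/=.
have tk : 0 < t `^ (k - 1) by exact: powR_gt0.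
rewrite -/k => /eqP; rewrite subr_eq0 => /eqP ->.
by rewrite /k in tk *; field; rewrite ?gt_eqF.
Qed.

End tangent.
End Phi.

(** * The second moment of the estimator *)

Section SecondMoment.
Variable R : realType.
Implicit Types (p t alpha beta : R).

Lemma graph_edge_density n (X : graph n) : (0 < n)%N ->
  n%:R ^+ 2 * edge_density (@graphon_of R n X) = 2 * \sum_e (X e)%:R.
Proof.
move=> n0; rewrite graphon_ofE edge_density_step// mulrC divfK ?expf_neq0 ?pnatr_eq0 -?lt0n//.
under eq_bigr do under eq_bigr do rewrite edge_mx_adjacent.
by rewrite (sum_edge_mx _ id) mulr0 add0r.
Qed.

(** The Erdos-Renyi law is itself an exponential tilt of the uniform law by the
    number of edges; this is where the parameter [ln (p / (1 - p))] comes from. *)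
Lemma bernoulli_mass_expR n p (X : graph n) : 0 < p < 1 ->
  bernoulli_mass (fun=> p) X =
  (1 - p) ^+ #|{: vertex_pair n}| * expR (ln (p / (1 - p)) * \sum_e (X e)%:R).
Proof.
move=> /andP[p0 p1]; have p1' : 0 < 1 - p by rewrite subr_gt0.
rewrite mulr_sumr expR_sum -prodr_const -big_split/=; apply: eq_bigr => e _.
case: (X e); last by rewrite mulr0 expR0 mulr1.
by rewrite mulr1 lnK ?posrE ?divr_gt0// mulrC divfK// gt_eqF.
Qed.

Section fixed_n.
Variables (n : nat) (p t alpha beta : R).
Hypotheses (n0 : (0 < n)%N) (p01 : 0 < p < 1).
Let P (X : graph n) : R := bernoulli_mass (fun=> p) X.
Let T (X : graph n) : R := triangle_density (@graphon_of R n X).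
Let G (X : graph n) : R := expR (n%:R ^+ 2 * (beta / 6 * T X `^ alpha)).
Let M : R := \sum_X P X * G X.
Let hit (X : graph n) : R := (t ^+ 3 <= T X)%R%:R.
Let q := @triangle_tilt R n (ln (p / (1 - p))) beta alpha.

Let P0 X : 0 < P X. Proof. exact: bernoulli_mass_gt0. Qed.
Let G0 X : 0 < G X. Proof. exact: expR_gt0. Qed.

Lemma tilt_partition_gt0 : 0 < M.
Proof.
rewrite /M (bigD1 [ffun=> false])//= ltr_pwDl ?mulr_gt0//.
by apply: sumr_ge0 => X _; rewrite mulr_ge0// ltW.
Qed.

Lemma triangle_tiltE X : q X = P X * G X / M.
Proof.
have k0 : (1 - p) ^+ #|{: vertex_pair n}| != 0 :> R.
  by rewrite expf_neq0// gt_eqF// subr_gt0; case/andP: p01.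
have wE Y : tilt_weight (ln (p / (1 - p))) beta alpha Y =
    ((1 - p) ^+ #|{: vertex_pair n}|)^-1 * (P Y * G Y).
  rewrite /P bernoulli_mass_expR// -!mulrA mulKf// -expRD /tilt_weight; congr expR.
  rewrite mulrDr mulrCA graph_edge_density// -/(T Y); congr (_ + _).
  by rewrite mulrA divfK ?pnatr_eq0.
rewrite /q /triangle_tilt wE (eq_bigr _ (fun Y _ => wE Y)) -mulr_sumr -/M.
by rewrite invfM invrK mulrACA mulVf ?mul1r.
Qed.

Lemma second_momentE :
  expect q (fun X => is_estimator p t q X ^+ 2) = M * \sum_X P X * hit X / G X.
Proof.
rewrite /expect mulr_sumr; apply: eq_bigr => X _.
have -> : is_estimator p t q X = hit X * (P X / q X).
  rewrite /is_estimator; congr (_ * _); rewrite indicE /hit.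
  rewrite (_ : (_ \in _) = (t ^+ 3 <= T X))//; apply/idP/idP; first by rewrite inE => -[].
  by move=> h; rewrite inE; split => //; exact: graphons_graphon_of.
rewrite triangle_tiltE; have M0 := tilt_partition_gt0.
have -> : hit X * (P X / (P X * G X / M)) = hit X * (M / G X).
  by field; rewrite !gt_eqF.
have hit2 : hit X ^+ 2 = hit X by rewrite /hit; case: (_ <= _); rewrite ?expr1n ?expr0n.
by rewrite exprMn hit2; field; rewrite !gt_eqF.
Qed.

(** Cauchy-Schwarz, in the form [2 * l <= G + l ^ 2 / G] averaged over the event,
    with [l = M / P A]. *)
Lemma second_moment_ge : 0 < \sum_X P X * hit X ->
  (\sum_X P X * hit X) ^+ 2 <= expect q (fun X => is_estimator p t q X ^+ 2).
Proof.
move=> PA0; rewrite second_momentE; have M0 := tilt_partition_gt0.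
set A := \sum_X _ in PA0 *; set m := \sum_X _.
(* The square of G - l is nonnegative. *)
have key l : 2 * l * A <= M + l ^+ 2 * m.
  rewrite /A /M /m !mulr_sumr -big_split/=; apply: ler_sum => X _.
  have h01 : 0 <= hit X <= 1 by rewrite /hit; case: (t ^+ 3 <= T X); rewrite /= ?lexx ?ler01.
  have /andP[h0 h1] := h01.
  have -> : l ^+ 2 * (P X * hit X / G X) = P X * (hit X * (l ^+ 2 / G X)) by field; rewrite gt_eqF.
  have -> : 2 * l * (P X * hit X) = P X * (hit X * (2 * l)) by ring.
  rewrite -mulrDr ler_pM2l//.
  apply: (@le_trans _ _ (hit X * (G X + l ^+ 2 / G X))); last first.
    by rewrite mulrDr lerD2r ler_piMl ?(ltW (G0 X)).
  apply: ler_wpM2l => //; rewrite -subr_ge0.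
  have -> : G X + l ^+ 2 / G X - 2 * l = (G X - l) ^+ 2 / G X by field; rewrite gt_eqF.
  by rewrite divr_ge0 ?sqr_ge0 ?(ltW (G0 X)).
have := key (M / A).
have -> : 2 * (M / A) * A = M + M by field; rewrite gt_eqF.
rewrite lerD2l => h.
have : M / A * (M / A) * m = M * (M * m / A ^+ 2) by field; rewrite gt_eqF.
rewrite -expr2 => E; rewrite E in h.
move: h; rewrite -{1}[M]mulr1 ler_pM2l// ler_pdivlMr ?exprn_gt0// mul1r.
by [].
Qed.

(** On the event the weight [G] is at least [exp (n^2 g (t ^ 3))], so that the
    indicator divided by [G] is at most [G] times [exp (- 2 n^2 g (t ^ 3))]. *)
Lemma second_moment_le : 0 < t -> 0 <= beta -> 0 < alpha ->
  expect q (fun X => is_estimator p t q X ^+ 2) <=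
  (M * expR (- (n%:R ^+ 2 * (beta / 6 * t `^ (3 * alpha))))) ^+ 2.
Proof.
move=> t0 b0 al0; rewrite second_momentE; have M0 := tilt_partition_gt0.
rewrite exprMn expr2 -mulrA ler_pM2l// /M mulr_suml; apply: ler_sum => X _.
set g := n%:R ^+ 2 * _.
rewrite -!mulrA ler_pM2l//.
rewrite /hit; case: (leP (t ^+ 3) (T X)) => hT; last by rewrite /= mul0r mulr_ge0 ?exprn_ge0 ?expR_ge0 ?(ltW (G0 X)).
rewrite /= mul1r -expRN -[expR (- g) ^+ 2]expRM_natl -expRD ler_expR.
have : g <= n%:R ^+ 2 * (beta / 6 * T X `^ alpha).
  rewrite /g; apply: ler_wpM2l; first exact: sqr_ge0.
  apply: ler_wpM2l; first by rewrite divr_ge0.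
  rewrite powRrM (powR_mulrn 3 (ltW t0)).
  apply: ge0_ler_powR hT; rewrite ?nnegrE ?(ltW al0) ?exprn_ge0 ?(ltW t0)//.
  by have /andP[] := triangle_density01 (graphons_graphon_of R X n0).
move: (n%:R ^+ 2 * _) => u; lra.
Qed.

End fixed_n.
End SecondMoment.

Theorem proposition4p3 (R : realType) (p t alpha beta : R)
    (hp : 0 < p) (hpt : p < t) (ht : t < 1)
    (halpha0 : 0 < alpha) (halpha1 : alpha <= 1)
    (hminorant : minorant_condition p t alpha)
    (hbeta : subdifferential (convex_minorant (rescaled_phi p alpha))
               (t `^ (3 * alpha)) (beta / 6)) :
  asymptotically_optimal p t
    (fun n => @triangle_tilt R n (ln (p / (1 - p))) beta alpha) /\
  (derivable (phi p) t 1 ->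
   beta = 2 * derive1 (phi p) t / (alpha * t `^ (3 * alpha - 1))).
Proof.
split; last exact: (beta_derivative hp hpt ht halpha0 hminorant hbeta).
have t0 : 0 < t by exact: lt_trans hpt.
have p01 : 0 < p < 1 by rewrite hp (lt_trans hpt).
have t01 : 0 < t < 1 by rewrite t0.
have al01 : 0 < alpha <= 1 by rewrite halpha0.
have b0 := beta_ge0 hp hpt ht halpha0 hminorant hbeta.
have tangent := graphon_tangent hp hpt ht halpha0 hminorant hbeta.
pose I := inf [set graphon_rate p f | f in upper_tail t].
have tI01 : 0 <= t <= 1 by rewrite (ltW t0) (ltW ht).
have [gt Tt _] := constant_graphon tI01.
have I_lb : has_lbound [set graphon_rate p f | f in upper_tail t].
  by exists 0 => _ [f [gf _] <-]; exact: graphon_rate_ge0.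
have I_ne : [set graphon_rate p f | f in upper_tail t] !=set0.
  by exists (graphon_rate p (fun=> t)), (fun=> t) => //; split => //; rewrite Tt.
have I_phi : I <= phi p t.
  apply: lb_le_inf; first by exists (graphon_rate p (fun=> t)), (fun=> t).
  move=> _ [f [gf Tf] <-]; apply: ge_inf => //; exists f => //.
  by split => //; rewrite Tf.
rewrite /asymptotically_optimal -/I; apply/cvgrPdist_le => eps eps0.
have eps4 : 0 < eps / 4 by rewrite divr_gt0.
have eps2 : 0 < eps / 2 by rewrite divr_gt0.
have [_ [f tf <-] If] := inf_adherent eps4 (conj I_ne I_lb).
rewrite -/I in If.
have upper := tilted_mean_upper p01 al01 b0 tangent eps2.
have lower := upper_tail_lower p01 t01 tf eps4.
apply: filterS3 (nbhs_infty_gt 0) upper lower => n n0.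
set g := beta / 6 * t `^ (3 * alpha); set M := \sum_X _; set A := \sum_X _.
move=> hM hA; set S := expect _ _.
have n2 : 0 < n%:R ^+ 2 :> R by rewrite exprn_gt0// ltr0n.
have A0 : 0 < A by exact: lt_le_trans (expR_gt0 _) hA.
have SA : A ^+ 2 <= S by exact: second_moment_ge.
have S0 : 0 < S by apply: lt_le_trans SA; rewrite exprn_gt0.
have SM : S <= (M * expR (- (n%:R ^+ 2 * g))) ^+ 2 by exact: second_moment_le.
have lnS_le : ln S <= n%:R ^+ 2 * (- 2 * phi p t + eps).
  rewrite -[leRHS]expRK ler_ln ?posrE ?expR_gt0//; apply: (le_trans SM).
  have M0 : 0 <= M by rewrite ltW//; exact: tilt_partition_gt0.
  have le1 : M * expR (- (n%:R ^+ 2 * g)) <= expR (n%:R ^+ 2 * (eps / 2 - phi p t)).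
    apply: (le_trans (ler_wpM2r (expR_ge0 _) hM)).
    rewrite -expRD ler_expR -mulrBr; apply: ler_wpM2l; first exact: ltW.
    by rewrite /g; clear; lra.
  apply: (@le_trans _ _ (expR (n%:R ^+ 2 * (eps / 2 - phi p t)) ^+ 2)).
    by rewrite ler_pXn2r ?nnegrE ?expR_ge0// mulr_ge0// expR_ge0.
  rewrite -expRM_natl ler_expR le_eqVlt; apply/orP; left; apply/eqP.
  by field.
have lnS_ge : n%:R ^+ 2 * (- 2 * I - eps) <= ln S.
  rewrite -[leLHS]expRK ler_ln ?posrE ?expR_gt0//; apply: le_trans SA.
  apply: (@le_trans _ _ (expR (- (n%:R ^+ 2 * (graphon_rate p f + eps / 4))) ^+ 2)).
    rewrite -expRM_natl ler_expR.
    have := ler_wpM2l (ltW n2) (ltW If); move: (graphon_rate p f) (n%:R ^+ 2) => I0 k.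
    by move: (I) => I1; rewrite !mulrDr; clear; lra.
  by rewrite ler_pXn2r ?nnegrE ?expR_ge0 ?(ltW A0).
rewrite ler_norml; apply/andP; split.
  rewrite lerBrDl -lerBrDr opprK ler_pdivrMr//.
  apply: (le_trans lnS_le); rewrite mulrC; apply: ler_wpM2r; first exact: ltW.
  by move: I_phi; clear; lra.
rewrite lerBlDl -lerBlDr ler_pdivlMr//.
by apply: le_trans lnS_ge; rewrite mulrC.
Qed.
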